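(* Let $(E,\Lambda)$ be the linear $n$-periodic discrete Lagrangian system obtained by linearization at an $n$-periodic trajectory of a discrete Lagrangian system on an $m$-dimensional manifold, let $V\subset\operatorname{Ker}(P-I)$ be an isotropic subspace of dimension $k$, and assume that the matrices $G_i$ are nondegenerate for all $i$. Let $\widetilde P$ be the reduced Poincaré map and let $\mathbf{H}^\perp,\mathbf{B}^\perp:X^\perp\to (X^\perp)^*$ and $A_i^\perp,B_i^\perp$ be the operators of the reduced system. Then the following reduced Hill formula holds: $$\det(\widetilde P-I)=\frac{\det\mathbf{H}^\perp}{\det\mathbf{B}^\perp}=\sigma^\perp(-1)^{m-k}\beta^\perp\det\mathbf{H}^\perp,$$ where $\sigma^\perp\in\{1,-1\}$ and $\beta^\perp>0$ are defined by $\sigma^\perp\beta^\perp=\bigl(\prod_{i=1}^n\det B_i^\perp\bigr)^{-1}$.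
   Context: Summation over repeated Greek indices from $1$ to $k$ is assumed. For a discrete Lagrangian $L$ on $M\times M$ and an $n$-periodic trajectory $(x_i)$ (i.e. $x_{i+n}=x_i$ and $\partial_2L(x_{i-1},x_i)+\partial_1L(x_i,x_{i+1})=0$), put $E_i=T_{x_i}M$, $A_i=\partial_{22}L(x_{i-1},x_i)+\partial_{11}L(x_i,x_{i+1}):E_i\to E_i^*$ (symmetric), $B_i=-\partial_1\partial_2L(x_i,x_{i+1}):E_i\to E_{i+1}^*$, assumed nondegenerate. Trajectories of the linearization $(E,\Lambda)$ are sequences $u_i\in E_i$ with $A_iu_i-B_{i-1}u_{i-1}-B_i^*u_{i+1}=0$, $i\in\mathbb{Z}$. $W$ is the $2m$-dimensional space of trajectories (identified with pairs $(u_0,u_1)$), $P:W\to W$, $(u_0,u_1)\mapsto(u_n,u_{n+1})$, is the Poincaré map, and $\omega(\mathbf{u},\mathbf{v})=\langle B_ju_j,v_{j+1}\rangle-\langle B_jv_j,u_{j+1}\rangle$ (independent of $j$) the $P$-invariant symplectic form. For an isotropic $V\subset\operatorname{Ker}(P-I)$, $\widetilde P$ is the symplectic map induced by $P$ on $\widetilde W=V^\omega/V$, where $V^\omega=\{u\in W:\omega(w,u)=0\ \forall w\in V\}$. Let $\mathbf{w}^\alpha=(w_i^\alpha)$, $\alpha=1,\dots,k$, be the $n$-periodic trajectories corresponding to a basis of $V$; $G_i=(g_i^{\alpha\beta})$, $g_i^{\alpha\beta}=\langle B_iw_i^\alpha,w_{i+1}^\beta\rangle$ (a symmetric matrix), $(g_{\alpha\beta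 i})=G_i^{-1}$. Reduced system: $E_i^\perp=\{u\in E_i:\langle B_{i-1}w_{i-1}^\alpha,u\rangle=0,\ \alpha=1,\dots,k\}$, $X^\perp=E_1^\perp\times\dots\times E_n^\perp$, $R_i:E_i^*\to(E_i^\perp)^*$ is restriction, $C_i$ is the symmetric operator on $E_i^\perp$ with $\langle C_iv,v\rangle=g_{\alpha\beta i}\langle B_iv,w_{i+1}^\alpha\rangle\langle B_iv,w_{i+1}^\beta\rangle$, $A_i^\perp=R_i(A_i-C_i)$, $B_i^\perp=R_{i+1}B_i$ (as operators on $E_i^\perp$). With $v_0=v_n$, $v_{n+1}=v_1$: $(\mathbf{H}^\perp\mathbf{v})_i=A_i^\perp v_i-(B_i^\perp)^*v_{i+1}-B_{i-1}^\perp v_{i-1}$ and $(\mathbf{B}^\perp\mathbf{v})_i=-B_{i-1}^\perp v_{i-1}$. Determinants are taken with respect to bases chosen in the spaces $E_i^\perp$, $i=1,\dots,n$. *)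

(* Defs.v *)
From HB Require Import structures.
From mathcomp Require Import all_boot all_order all_algebra.
From mathcomp Require Import all_classical all_reals all_analysis.

Set Implicit Arguments.
Unset Strict Implicit.
Unset Printing Implicit Defensive.

Import Order.TTheory GRing.Theory Num.Theory.
Import numFieldNormedType.Exports.

Local Open Scope classical_set_scope.
Local Open Scope ring_scope.

Definition nperiodic (T : Type) (n : nat) (x : int -> T) : Prop :=
  forall i, x (i + n%:Z) = x i.

Section Manifolds.
Context {R : realType}.

Definition C2_on (V : normedModType R) (U : set V) (f : V -> R) : Prop :=
  forall x, U x ->
    {for x, continuous f} /\
    forall v, [/\ derivable f x v, {for x, continuous ('D_v f)} &
      forall w, derivable ('D_v f) x w /\ {for x, continuous ('D_w ('D_v f))}].

(* [chart_inv] is only meaningful on the image of [chart_dom]. *)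
Record chart (m : nat) (M : Type) := Chart {
  chart_dom : set M;
  chart_map : M -> 'cV[R]_m;
  chart_inv : 'cV[R]_m -> M }.

Definition chart_img (m : nat) (M : Type) (c : chart m M) : set 'cV[R]_m :=
  chart_map c @` chart_dom c.

Definition is_chart (m : nat) (M : topologicalType) (c : chart m M) : Prop :=
  [/\ open (chart_dom c), open (chart_img c),
      {within chart_dom c, continuous (chart_map c)},
      {within chart_img c, continuous (chart_inv c)} &
      forall p, chart_dom c p -> chart_inv c (chart_map c p) = p].

Definition is_atlas (m : nat) (M : topologicalType) (atl : set (chart m M)) :
    Prop :=
  [/\ forall c, atl c -> is_chart c,
      forall p, exists2 c, atl c & chart_dom c p &
      forall c d, atl c -> atl d -> forall j : 'I_m,
        C2_on (chart_map c @` (chart_dom c `&` chart_dom d))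
              (fun a => chart_map d (chart_inv c a) j 0)].

Definition is_manifold (m : nat) (M : topologicalType)
    (atl : set (chart m M)) : Prop :=
  [/\ hausdorff_space M, @second_countable M & is_atlas atl].

Section Lagrangian.
Variables (m : nat) (M : Type) (L : M -> M -> R).

Definition local_rep (c d : chart m M) (z : 'cV[R]_m * 'cV[R]_m) : R :=
  L (chart_inv c z.1) (chart_inv d z.2).

Definition C2_lagrangian (atl : set (chart m M)) : Prop :=
  forall c d, atl c -> atl d ->
    C2_on (chart_img c `*` chart_img d) (local_rep c d).

(* Below, [phi i] is a chart around [x i]; it identifies T_{x_i} M with R^m. *)
Variables (phi : int -> chart m M) (x : int -> M).

Definition Lloc (i : int) : 'cV[R]_m * 'cV[R]_m -> R :=
  local_rep (phi i) (phi (i + 1)).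

Definition zloc (i : int) : 'cV[R]_m * 'cV[R]_m :=
  (chart_map (phi i) (x i), chart_map (phi (i + 1)) (x (i + 1))).

Definition is_trajectory : Prop := forall i (v : 'cV[R]_m),
  'D_((0 : 'cV[R]_m), v) (Lloc (i - 1)) (zloc (i - 1))
    + 'D_(v, (0 : 'cV[R]_m)) (Lloc i) (zloc i) = 0.

(* Operators E_i -> E_j^* are matrices T with <T u, v> = v^T T u, so that the
   column index belongs to E_i, the row index to E_j, and T^* is T^T. *)
Record linear_system := LinearSystem {
  opA : int -> 'M[R]_m;
  opB : int -> 'M[R]_m }.

Let ev (a : 'I_m) : 'cV[R]_m := delta_mx a 0.
Let ev1 (a : 'I_m) : 'cV[R]_m * 'cV[R]_m := (ev a, 0).
Let ev2 (a : 'I_m) : 'cV[R]_m * 'cV[R]_m := (0, ev a).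

(* The two summands of A_i depend on the chart [phi i], but, by the
   trajectory equation, their sum is a bilinear form on T_{x_i} M. *)
Definition linearization : linear_system := LinearSystem
  (fun i => \matrix_(a, b)
     ('D_(ev2 b) ('D_(ev2 a) (Lloc (i - 1))) (zloc (i - 1))
      + 'D_(ev1 b) ('D_(ev1 a) (Lloc i)) (zloc i)))
  (fun i => \matrix_(a, b) - 'D_(ev1 b) ('D_(ev2 a) (Lloc i)) (zloc i)).

End Lagrangian.
End Manifolds.

Arguments chart : clear implicits.
Arguments linear_system : clear implicits.

Definition det_end (K : fieldType) (U : vectType K) (f : 'End(U)) : K :=
  \det (passmx.mxof (vbasis {:U}) (vbasis {:U}) f).

(* [b] is the form <T u, v> of an operator T : U -> V^*; this is det T with
   respect to the basis e of U and the basis of V^* dual to f. *)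
Definition det_form (K : fieldType) (U V : Type) (I : finType)
    (b : U -> V -> K) (e : I -> U) (f : I -> V) : K :=
  \det (\matrix_(s < #|I|, t < #|I|) b (e (enum_val t)) (f (enum_val s))).

Section LinearSystem.
Context {R : realType} {m : nat}.
Variable Lam : linear_system R m.
Local Notation A := (opA Lam).
Local Notation B := (opB Lam).
Local Notation W := ('cV[R]_m * 'cV[R]_m)%type.

Definition pairing (f u : 'cV[R]_m) : R := (f^T *m u) 0 0.
Local Notation "<< f , u >>" := (pairing f u).

Definition is_lin_trajectory (u : int -> 'cV[R]_m) : Prop := forall i,
  A i *m u i - B (i - 1) *m u (i - 1) - (B i)^T *m u (i + 1) = 0.

(* A trajectory u is represented in W by the pair (u_0, u_1). *)
Definition is_poincare_map (n : nat) (P : 'End(W)) : Prop :=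
  forall u, is_lin_trajectory u -> P (u 0, u 1) = (u n%:Z, u (n%:Z + 1)).

(* The symplectic form, computed at j = 0. *)
Definition omega (u v : W) : R :=
  << B 0 *m u.1, v.2 >> - << B 0 *m v.1, u.2 >>.

Definition isotropic (V : {vspace W}) : Prop :=
  forall u v, u \in V -> v \in V -> omega u v = 0.

Definition omega_orth (V : {vspace W}) : {vspace W} :=
  lker (linfun (fun u : W => \row_(j < \dim V) omega (vbasis V)`_j u)).

Lemma pairing_linear f : linear (pairing f : 'cV[R]_m -> R^o).
Proof.
by move=> a u v; rewrite /pairing mulmxDr -scalemxAr !mxE.
Qed.

Lemma pairing_linearl u : linear (pairing ^~ u : 'cV[R]_m -> R^o).
Proof.
by move=> a f g; rewrite /pairing linearP mulmxDl -scalemxAl !mxE.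
Qed.

Lemma omega_linear u : linear (omega u : W -> R^o).
Proof.
move=> a v v'; rewrite /omega /= mulmxDr -scalemxAr.
by rewrite (pairing_linear _ a) (pairing_linearl _ a) scalerBr opprD addrACA.
Qed.

Lemma omega_linearl v : linear (omega ^~ v : W -> R^o).
Proof.
move=> a u u'; have sk x y : omega x y = - omega y x by rewrite /omega opprB.
by rewrite !(sk _ v) (omega_linear v a) opprD scalerN.
Qed.

Lemma omega_orthP (V : {vspace W}) u :
  reflect (forall w, w \in V -> omega w u = 0) (u \in omega_orth V).
Proof.
have lin : linear (fun u : W => \row_(j < \dim V) omega (vbasis V)`_j u).
  move=> a x y; apply/rowP => j; rewrite !mxE.
  exact: (omega_linear _ a).
pose F := HB.pack (fun u : W => \row_(j < \dim V) omega (vbasis V)`_j u)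
  (GRing.isLinear.Build R W 'rV[R]_(\dim V) *:%R _ lin) :
  {linear W -> 'rV[R]_(\dim V)}.
rewrite memv_ker -[fun _ => _]/(F : W -> _) lfunE /=.
apply: (iffP eqP) => [/rowP h w wV|h]; last first.
  apply/rowP => j; rewrite !mxE; apply/h/vbasis_mem/mem_nth.
  by rewrite size_tuple.
rewrite (coord_vbasis wV).
pose G := HB.pack (omega ^~ u : W -> R^o)
  (GRing.isLinear.Build R W R^o *:%R _ (omega_linearl u)) :
  {linear W -> R^o}.
rewrite -[LHS]/(G _) linear_sum big1 // => j _.
rewrite linearZ /= -[omega _ _]/(omega (vbasis V)`_j u).
by move: (h j); rewrite !mxE => ->; rewrite scaler0.
Qed.

(* The linear map prj : U -> Wt exhibits Wt as the quotient U / V, for V <= U. *)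
Definition is_quotient_map (U V : {vspace W}) (Wt : vectType R)
    (prj : 'Hom(subvs_of U, Wt)) : Prop :=
  limg prj = fullv /\ forall u, prj u = 0 <-> vsval u \in V.

Definition is_induced_map (U : {vspace W}) (Wt : vectType R)
    (prj : 'Hom(subvs_of U, Wt)) (P : 'End(W)) (Pt : 'End(Wt)) : Prop :=
  forall u u', vsval u' = P (vsval u) -> Pt (prj u) = prj u'.

Section Reduction.
Context {k : nat}.
Variable w : 'I_k -> int -> 'cV[R]_m.

Definition matG (i : int) : 'M[R]_k :=
  \matrix_(a, b) << B i *m w a i, w b (i + 1) >>.

Definition Eperp (i : int) : {vspace 'cV[R]_m} :=
  lker (linfun (fun u : 'cV[R]_m =>
    \row_(a < k) << B (i - 1) *m w a (i - 1), u >>)).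

Lemma EperpP i u :
  reflect (forall a, << B (i - 1) *m w a (i - 1), u >> = 0) (u \in Eperp i).
Proof.
have lin : linear (fun u : 'cV[R]_m =>
    \row_(a < k) << B (i - 1) *m w a (i - 1), u >>).
  by move=> a x y; apply/rowP => j; rewrite !mxE; exact: (pairing_linear _ a).
pose F := HB.pack (fun u : 'cV[R]_m =>
    \row_(a < k) << B (i - 1) *m w a (i - 1), u >>)
  (GRing.isLinear.Build R 'cV[R]_m 'rV[R]_k *:%R _ lin) :
  {linear 'cV[R]_m -> 'rV[R]_k}.
rewrite memv_ker -[fun _ => _]/(F : 'cV[R]_m -> _) lfunE /=.
apply: (iffP eqP) => [/rowP h a|h]; first by move: (h a); rewrite !mxE.
by apply/rowP => a; rewrite !mxE.
Qed.

Definition quadC (i : int) (v : 'cV[R]_m) : R :=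
  \sum_(a < k) \sum_(b < k) invmx (matG i) a b
    * << B i *m v, w a (i + 1) >> * << B i *m v, w b (i + 1) >>.

(* <C_i u, v>, where C_i is the symmetric operator with <C_i v, v> = quadC i v *)
Definition formC (i : int) (u v : 'cV[R]_m) : R :=
  (quadC i (u + v) - quadC i u - quadC i v) / 2.

(* An operator T from E_i^perp to (E_j^perp)^* is given by its bilinear form
   <T u, v>, u in E_i^perp, v in E_j^perp; composing with the restriction R_j
   amounts to taking v in E_j^perp only. *)
Definition Aperp (i : int) (u v : 'cV[R]_m) : R :=
  << A i *m u, v >> - formC i u v.

Definition Bperp (i : int) (u v : 'cV[R]_m) : R := << B i *m u, v >>.

(* X^perp, each (v_1, ..., v_n) being extended to an n-periodic sequence *)
Definition Xperp (n : nat) (v : int -> 'cV[R]_m) : Prop :=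
  nperiodic n v /\ forall i, v i \in Eperp i.

(* <(H v)_i, z> and <(B v)_i, z> for v in X^perp and z in E_i^perp *)
Definition Hperp_comp (v : int -> 'cV[R]_m) (i : int) (z : 'cV[R]_m) : R :=
  Aperp i (v i) z - Bperp i z (v (i + 1)) - Bperp (i - 1) (v (i - 1)) z.

Definition Bperp_comp (v : int -> 'cV[R]_m) (i : int) (z : 'cV[R]_m) : R :=
  - Bperp (i - 1) (v (i - 1)) z.

Definition Hperp (n : nat) (v z : int -> 'cV[R]_m) : R :=
  \sum_(1 <= i < n.+1) Hperp_comp v i%:Z (z i%:Z).

Definition boldBperp (n : nat) (v z : int -> 'cV[R]_m) : R :=
  \sum_(1 <= i < n.+1) Bperp_comp v i%:Z (z i%:Z).

End Reduction.

(* The basis of X^perp given by bases e_i of E_i^perp with e_{i+n} = e_i: the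
   vector with index (i, a) has the a-th vector of the basis of E_{i+1}^perp
   as its (i+1)-st component, its other components being 0. *)
Definition basis_Xperp (n d : nat) (e : int -> d.-tuple 'cV[R]_m)
    (s : 'I_n * 'I_d) (j : int) : 'cV[R]_m :=
  if (j == s.1.+1%:Z %[mod n%:Z])%Z then tnth (e j) s.2 else 0.

Definition det_Bperp (d : nat) (e : int -> d.-tuple 'cV[R]_m) (i : int) : R :=
  det_form (Bperp i) (tnth (e i)) (tnth (e (i + 1))).

Definition det_Hperp (k n d : nat) (w : 'I_k -> int -> 'cV[R]_m)
    (e : int -> d.-tuple 'cV[R]_m) : R :=
  det_form (Hperp w n) (@basis_Xperp n d e) (@basis_Xperp n d e).

Definition det_boldBperp (n d : nat) (e : int -> d.-tuple 'cV[R]_m) : R :=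
  det_form (boldBperp n) (@basis_Xperp n d e) (@basis_Xperp n d e).

Lemma basis_Xperp_mem (k n d : nat) (w : 'I_k -> int -> 'cV[R]_m)
    (e : int -> d.-tuple 'cV[R]_m) (s : 'I_n * 'I_d) :
  nperiodic n e -> (forall i, basis_of (Eperp w i) (e i)) ->
  Xperp w n (basis_Xperp e s).
Proof.
move=> eper eb; split=> i; rewrite /basis_Xperp.
  by rewrite eper modzDr.
case: ifP => _; last exact: mem0v.
exact: (basis_mem (eb i) (mem_tnth _ _)).
Qed.

End LinearSystem.

(* Main.v *)
Require Import Defs.
From HB Require Import structures.
From mathcomp Require Import all_boot all_order all_algebra.
From mathcomp Require Import fingroup perm.
From mathcomp Require Import all_classical all_reals all_analysis.
From mathcomp Require Import zify ring.

Set Implicit Arguments.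
Unset Strict Implicit.
Unset Printing Implicit Defensive.

Import Order.TTheory GRing.Theory Num.Theory.
Import numFieldNormedType.Exports.

Local Open Scope ring_scope.

(** The formula is the ordinary Hill formula of the reduced system, once the
    reduced Poincare map is recognized as the monodromy of that system.

    Let the columns of W_i be the vectors w_i^1, ..., w_i^k and those of Q_i a
    basis of E_i^perp. As the matrix G_(i-1) is nondegenerate, E_i is the
    direct sum of E_i^perp and of the span of W_i, so every trajectory can be
    written u_i = Q_i y_i + W_i c_i ([Q_decomp]). If u is in V^omega, the
    condition omega (w, u) = 0 at the index i gives c_(i+1) - c_i as a
    function of y_i ([coef_step]); eliminating the c_i from the linearized
    equations leaves exactly the reduced system for the y_i ([reduced_eq]).
    This uses that omega does not depend on the index, that is, that the A_i
    are symmetric, which is Schwarz's theorem ([C2_derive_comm],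
    [linearization_opA_sym]). Adding to u a trajectory of V changes the c_i by
    a constant only. Hence (y_0, y_1) is a system of coordinates on the
    quotient of V^omega by V ([lift_ker], [lift_decomp]), in which the reduced
    Poincare map is M : (y_0, y_1) |-> (y_n, y_(n+1)) ([reduced_monodromy]).

    It remains to compute det (1 - M) for a recursion with matrices a_i and
    b_i, the latter being invertible ([redb_unit]). Let S be the cyclic shift
    of the blocks. Written in the shifted unknowns, H is H' S, where H' is
    block lower triangular except for the terms that wrap around the period.
    Let L be the triangular part of H', Z the matrix of the solution of the
    recursion as a function of its initial data, and D the map that selects
    the last two blocks. The recursion says that L Z is the contribution of
    the initial data, which in H' is fed by the last two blocks; thus
    H' = L (1 - Z D), and
      det H' = det L det (1 - Z D) = det L det (1 - D Z) = det L det (1 - M)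
    ([det_hill_shift]). Likewise the transpose of the operator B is the
    product of the block diagonal part of L with S, so that
    det B = det L det S, and the quotient is det (1 - M) ([hill_formula]). As
    det L = (-1)^(n d) det b_1 ... det b_n, and as S, which consists of d
    cycles of length n, has determinant (-1)^(n d + d), it also follows that
    det B = (-1)^d det b_1 ... det b_n ([det_shift_mxE]). *)

(** * Determinants of block matrices *)

Section Det.
Variable F : comUnitRingType.

(** Sylvester's determinant identity. *)
Lemma det_1subC p q (X : 'M[F]_(p, q)) (Y : 'M[F]_(q, p)) :
  \det (1%:M - X *m Y) = \det (1%:M - Y *m X).
Proof.
have E1 : block_mx 1%:M X Y 1%:M *m block_mx 1%:M 0 (- Y) 1%:M
        = block_mx (1%:M - X *m Y) X 0 1%:M.
  by rewrite mulmx_block !mulmx1 !mulmx0 !mul1mx !mulmxN !add0r subrr.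
have E2 : block_mx 1%:M 0 (- Y) 1%:M *m block_mx 1%:M X Y 1%:M
        = block_mx 1%:M X 0 (1%:M - Y *m X).
  rewrite mulmx_block !mulmx1 !mul0mx !mul1mx !mulNmx !addr0 addNr.
  by rewrite [- _ + _]addrC.
have := congr1 determinant E1; have := congr1 determinant E2.
rewrite !det_mulmx det_lblock !det_ublock !det1 !mul1r !mulr1 => <- <-.
by [].
Qed.

(** Similar matrices have the same determinant; the formats are not assumed to
    be equal, so that no cast is needed to compare matrices in various bases. *)
Lemma det_intertwine p q (M1 : 'M[F]_p) (M2 : 'M[F]_q)
    (X : 'M[F]_(p, q)) (Y : 'M[F]_(q, p)) :
  X *m Y = 1%:M -> Y *m X = 1%:M -> M1 *m X = X *m M2 -> \det M1 = \det M2.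
Proof.
move=> XY YX MX.
have -> : M1 = 1%:M - X *m (Y - Y *m M1).
  by rewrite mulmxBr mulmxA XY mul1mx opprB addrC subrK.
rewrite det_1subC mulmxBl -mulmxA MX mulmxA YX mul1mx.
by rewrite opprB addrC subrK.
Qed.

Lemma det_reindex (I : finType) p q (G : I -> I -> F)
    (f : 'I_p -> I) (g : 'I_q -> I) :
  bijective f -> bijective g ->
  \det (\matrix_(s, t) G (f s) (f t)) = \det (\matrix_(s, t) G (g s) (g t)).
Proof.
move=> bf bg.
pose X (p' q' : nat) (f' : 'I_p' -> I) (g' : 'I_q' -> I) : 'M[F]_(p', q') :=
  \matrix_(s, t) (f' s == g' t)%:R.
have inv (p' q' : nat) (f' : 'I_p' -> I) (g' : 'I_q' -> I) :
    bijective f' -> bijective g' -> X _ _ f' g' *m X _ _ g' f' = 1%:M.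
  move=> bf' [g1 gK Kg]; apply/matrixP => s t; rewrite !mxE.
  rewrite (bigD1 (g1 (f' s))) //= !mxE Kg eqxx mul1r big1 ?addr0.
    by rewrite (inj_eq (bij_inj bf')).
  move=> j; rewrite !mxE; have [->|_ _] := eqVneq (f' s) (g' j).
    by rewrite gK eqxx.
  by rewrite mul0r.
apply: (det_intertwine (inv _ _ f g bf bg) (inv _ _ g f bg bf)).
case: (bf) (bg) => f1 fK Kf [g1 gK Kg].
apply/matrixP => s t; rewrite !mxE.
rewrite (bigD1 (f1 (g t))) //= !mxE Kf eqxx mulr1 big1 ?addr0; last first.
  move=> j; rewrite !mxE; have [<-|_ _] := eqVneq (f j) (g t).
    by rewrite fK eqxx.
  by rewrite mulr0.
rewrite (bigD1 (g1 (f s))) //= !mxE Kg eqxx mul1r big1 ?addr0 //.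
move=> j; rewrite !mxE; have [->|_ _] := eqVneq (f s) (g j).
  by rewrite gK eqxx.
by rewrite mul0r.
Qed.

Section Blocks.
Variables n d : nat.
Local Notation I := ('I_n * 'I_d)%type.

(** The square matrix with n x n blocks of size d, its rows and columns being
    numbered by the enumeration of the pairs (block, position in the block). *)
Definition bmx (G : 'I_n -> 'I_n -> 'M[F]_d) : 'M[F]_#|{: I}| :=
  \matrix_(s, t) G (enum_val s).1 (enum_val t).1 (enum_val s).2 (enum_val t).2.

(** The matrices made of one column, or of one row, of n blocks. *)
Definition bcol q (Z : 'I_n -> 'M[F]_(d, q)) : 'M[F]_(#|{: I}|, q) :=
  \matrix_(s, t) Z (enum_val s).1 (enum_val s).2 t.
Definition brow q (D : 'I_n -> 'M[F]_(q, d)) : 'M[F]_(q, #|{: I}|) :=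
  \matrix_(s, t) D (enum_val t).1 s (enum_val t).2.

Lemma eq_bmx (G1 G2 : 'I_n -> 'I_n -> 'M[F]_d) : G1 =2 G2 -> bmx G1 = bmx G2.
Proof. by move=> eqG; apply/matrixP => s t; rewrite !mxE eqG. Qed.

Lemma bmxB G1 G2 : bmx G1 - bmx G2 = bmx (fun i j => G1 i j - G2 i j).
Proof. by apply/matrixP => s t; rewrite !mxE. Qed.

Lemma sum_enum_val (h : I -> F) :
  \sum_(s < #|{: I}|) h (enum_val s) = \sum_i \sum_a h (i, a).
Proof.
rewrite pair_big [RHS](reindex (enum_val : 'I_#|{: I}| -> I)) /=.
  by apply: eq_bigr => s _; case: (enum_val s).
exact/onW_bij/enum_val_bij.
Qed.

Lemma mul_bmx_bcol q G (Z : 'I_n -> 'M[F]_(d, q)) :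
  bmx G *m bcol Z = bcol (fun i => \sum_j G i j *m Z j).
Proof.
apply/matrixP => s t; rewrite !mxE.
under eq_bigr do rewrite !mxE.
rewrite (sum_enum_val (fun x => G (enum_val s).1 x.1 (enum_val s).2 x.2 *
  Z x.1 x.2 t)) summxE; apply: eq_bigr => j _.
by rewrite mxE.
Qed.

Lemma mul_brow_bcol p q D (Z : 'I_n -> 'M[F]_(d, q)) :
  @brow p D *m bcol Z = \sum_j D j *m Z j.
Proof.
apply/matrixP => s t; rewrite !mxE.
under eq_bigr do rewrite !mxE.
rewrite (sum_enum_val (fun x => D x.1 s x.2 * Z x.1 x.2 t)) summxE.
by apply: eq_bigr => j _; rewrite mxE.
Qed.

Lemma mul_bcol_brow q (Z : 'I_n -> 'M[F]_(d, q)) D :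
  bcol Z *m brow D = bmx (fun i j => Z i *m D j).
Proof.
by apply/matrixP => s t; rewrite !mxE; apply: eq_bigr => j _; rewrite !mxE.
Qed.

Definition bdelta (i j : 'I_n) : 'M[F]_d := if i == j then 1%:M else 0.

Lemma bmx1 : bmx bdelta = 1%:M.
Proof.
apply/matrixP => s t; rewrite !mxE.
rewrite -(inj_eq enum_val_inj).
case: (enum_val s) (enum_val t) => [i a] [j b] /=.
by rewrite xpair_eqE /bdelta; case: (i == j); rewrite /= !mxE.
Qed.

Lemma det_bmx_trig (G : 'I_n -> 'I_n -> 'M[F]_d) :
  (forall i j : 'I_n, (i < j)%N -> G i j = 0) ->
  \det (bmx G) = \prod_i \det (G i i).
Proof.
move=> trigG.
(* P k has the first k block rows of G and the other block rows of the identity.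
   Passing from P k to P k.+1 multiplies it on the right by the identity with
   block row k replaced by that of G, a perturbation of 1 of rank at most d. *)
pose P k := bmx (fun i j => if (i < k)%N then G i j else bdelta i j).
have step (k : 'I_n) : \det (P k.+1) = \det (P k) * \det (G k k).
  have -> : P k.+1 = P k *m (1%:M -
      bcol (bdelta^~ k) *m brow (fun j => bdelta k j - G k j)).
    rewrite mulmxBr mulmx1 mulmxA mul_bmx_bcol.
    have -> : bcol (fun i => \sum_j (if (i < k)%N then G i j else bdelta i j)
                      *m bdelta j k) = bcol (bdelta ^~ k).
      apply/matrixP => s t; rewrite !mxE; set i := (enum_val s).1.
      rewrite (bigD1 k) //= big1 ?addr0 => [|j jk]; last first.
        by rewrite /bdelta (negPf jk) mulmx0.
      rewrite {2}/bdelta eqxx mulmx1; case: ltnP => // ik.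
      by rewrite trigG // /bdelta -val_eqE /= (ltn_eqF ik).
    rewrite mul_bcol_brow bmxB; apply: eq_bmx => i j.
    rewrite {3}/bdelta; have [->|ik] := eqVneq i k.
      by rewrite ltnSn ltnn mul1mx opprB addrC subrK.
    rewrite mul0mx subr0 ltnS leq_eqVlt.
    by move: ik; rewrite -val_eqE => /negPf ->.
  rewrite det_mulmx det_1subC mul_brow_bcol; congr (_ * \det _).
  rewrite (bigD1 k) //= big1 ?addr0 => [|j jk]; last first.
    by rewrite /bdelta (negPf jk) mulmx0.
  by rewrite /bdelta eqxx mulmx1 opprB addrC subrK.
have prodP k : (k <= n)%N -> \det (P k) = \prod_(i < n | (i < k)%N) \det (G i i).
  elim: k => [_|k IH kn].
    rewrite big1 // (_ : P 0%N = 1%:M) ?det1 // -bmx1.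
    exact: eq_bmx.
  rewrite (step (Ordinal kn)) IH ?(ltnW kn) //.
  rewrite [RHS](bigD1 (Ordinal kn)) ?ltnSn //= mulrC; congr (_ * _).
  apply: eq_bigl => i; by rewrite ltnS -val_eqE ltn_neqAle andbC.
have <- : P n = bmx G by apply: eq_bmx => i j; rewrite ltn_ord.
by rewrite prodP //; apply: eq_bigl => i; rewrite ltn_ord.
Qed.


Lemma ord_pred_gt0 (i : 'I_n) : (0 < i)%N -> ord_pred i = i.-1 :> nat.
Proof.
move=> i0 /=; rewrite -subn1 -addnBAC // subn1 modnDr modn_small //.
exact: leq_ltn_trans (leq_pred i) (ltn_ord i).
Qed.

Lemma iter_ord_pred k (i : 'I_n) : (k <= i)%N ->
  iter k (@ord_pred n) i = (i - k)%N :> nat.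
Proof.
elim: k => [|k IH] ki; first by rewrite subn0.
by rewrite iterS ord_pred_gt0 IH ?subnS ?(ltnW ki) // subn_gt0.
Qed.

(** The cyclic shift of the blocks, fixing the position in the block. *)
Definition bshift (x : I) : I := (ord_pred x.1, x.2).

Lemma bshift_inj : injective bshift.
Proof.
move=> [i u] [j v] eq_ij; have /= -> := congr1 snd eq_ij.
by have /= /(can_inj (@ord_predK n)) -> := congr1 fst eq_ij. Qed.

Lemma bshift_rank_inj :
  injective (fun t : 'I_#|{: I}| => enum_rank (bshift (enum_val t))).
Proof. by move=> s t /enum_rank_inj/bshift_inj/enum_val_inj. Qed.

(** The cycles of the shift are in bijection with the positions in a block. *)
Lemma card_porbits_bshift (n_gt0 : (0 < n)%N) :
  #|porbits (perm bshift_rank_inj)| = d.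
Proof.
set s := perm _; pose o a := porbit s (enum_rank (Ordinal n_gt0, a)).
have sX k t : enum_val ((s ^+ k)%g t) =
      (iter k (@ord_pred n) (enum_val t).1, (enum_val t).2).
  elim: k => [|k IH]; first by rewrite expg0 perm1; case: (enum_val t).
  by rewrite expgSr permM permE enum_rankK IH iterS.
have oE t : porbit s t = o (enum_val t).2.
  rewrite /o; set i := (enum_val t).1; rewrite -(porbit_perm s i t).
  congr (porbit s _); apply: enum_val_inj; rewrite enum_rankK sX.
  by congr (_, _); apply: val_inj; rewrite /= iter_ord_pred ?subnn.
have o_inj : injective o.
  move=> a b /eqP; rewrite eq_porbit_mem => /porbitP[k] /(congr1 enum_val).
  by rewrite sX !enum_rankK => -[].
rewrite -[RHS]card_ord -(card_imset _ o_inj); apply: eq_card => A.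
apply/imsetP/imsetP => [[t _ ->]|[a _ ->]]; first by exists (enum_val t).2.
by exists (enum_rank (Ordinal n_gt0, a)).
Qed.

Lemma det_bmx_shift (G : 'I_n -> 'I_n -> 'M[F]_d) : (0 < n)%N ->
  \det (bmx (fun i j => G i (ord_pred j))) = (-1) ^+ (n * d + d) * \det (bmx G).
Proof.
move=> n_gt0; set s := perm bshift_rank_inj.
have -> : bmx (fun i j => G i (ord_pred j)) = col_perm s (bmx G).
  by apply/matrixP => t1 t2; rewrite !mxE permE enum_rankK.
rewrite col_permE det_mulmx det_perm odd_permV mulrC; congr (_ * _).
rewrite /odd_perm card_porbits_bshift // card_ord card_prod !card_ord.
by rewrite -oddD signr_odd.
Qed.

End Blocks.

(** * Hill's formula for a second order recursion *)

Section Hill.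
Variables (n d : nat) (a b : nat -> 'M[F]_d).
Hypothesis n_gt0 : (0 < n)%N.

(** The matrix of the operator
      (H y)_i = a_i y_i - b_i^T y_(i+1) - b_(i-1) y_(i-1)
    on the n-periodic sequences y. Block row i stands for the equation of
    index i + 1 and block column j for the component y_(j+1). *)
Definition hill_mx (i j : 'I_n) : 'M[F]_d :=
  (if i == j then a i.+1 else 0)
  - (if i.+1 == j %[mod n] then (b i.+1)^T else 0)
  - (if j.+1 == i %[mod n] then b i else 0).

(** The same matrix in the unknowns z_l = y_(l+2): its blocks are those of a
    lower triangular matrix, apart from the terms that wrap around the period. *)
Definition hill_shift (i l : 'I_n) : 'M[F]_d :=
  (if l.+1 == i %[mod n] then a i.+1 else 0)
  - (if l == i then (b i.+1)^T else 0)
  - (if l.+2 == i %[mod n] then b i else 0).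

Lemma hill_mxE i j : hill_mx i j = hill_shift i (ord_pred j).
Proof.
have predS : (ord_pred j).+1 = j %[mod n].
  rewrite /= -addn1 modnDml addn1 prednK; first by rewrite modnDr.
  by rewrite addn_gt0 n_gt0 orbT.
have c1 : ((ord_pred j).+1 == i %[mod n]) = (i == j).
  by rewrite predS !modn_small // eq_sym.
have c2 : (ord_pred j == i) = (i.+1 == j %[mod n]).
  rewrite -(inj_eq (can_inj (@ordSK n))) ord_predK eq_sym -val_eqE /=.
  by rewrite [(j %% n)%N]modn_small.
have c3 : ((ord_pred j).+2 == i %[mod n]) = (j.+1 == i %[mod n]).
  by rewrite -addn1 -modnDml predS modnDml addn1.
by rewrite /hill_mx /hill_shift c1 c2 c3.
Qed.

(* The solution of the recursion whose columns have, as initial data (y_0, y_1),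
   the vectors of the canonical basis. *)
Variable Y : nat -> 'M[F]_(d, d + d).
Hypothesis Y0 : Y 0%N = row_mx 1%:M 0.
Hypothesis Y1 : Y 1%N = row_mx 0 1%:M.
Hypothesis Yrec : forall i, (i < n)%N ->
  (b i.+1)^T *m Y i.+2 = a i.+1 *m Y i.+1 - b i *m Y i.

Lemma sum_if_mul q (P : pred 'I_n) (M : 'M[F]_d) (Z : 'I_n -> 'M[F]_(d, q)) :
  \sum_j (if P j then M else 0) *m Z j = M *m \sum_(j | P j) Z j.
Proof.
rewrite mulmx_sumr [RHS]big_mkcond; apply: eq_bigr => j _.
by case: ifP => // _; rewrite mul0mx.
Qed.

(** The heart of Hill's formula: [hill_shift] is L (1 - Z D), where L is its
    part without wrapping, Z is the solution Y, and D selects the last two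
    blocks, so that D Z is the monodromy matrix if n > 1. *)
Lemma det_hill_shift :
  \det (bmx hill_shift) =
  \prod_(i < n) \det (- (b i.+1)^T) * \det (1%:M - col_mx (Y n) (Y n.+1)).
Proof.
pose L (i j : 'I_n) : 'M[F]_d := (if j.+1 == i then a i.+1 else 0)
  - (if j == i then (b i.+1)^T else 0) - (if j.+2 == i then b i else 0).
pose Z (i : 'I_n) := Y i.+2.
pose D (j : 'I_n) : 'M[F]_(d + d, d) :=
  col_mx (if j.+2 == 0 %[mod n] then 1%:M else 0)
         (if j.+1 == n then 1%:M else 0).
have S1 (i : 'I_n) : \sum_(j : 'I_n | j.+1 == i) Z j =
    if i == 0 :> nat then 0 else Y i.+1.
  case: i => [[|i] ilt] /=; first by rewrite big_pred0.
  by rewrite (big_pred1 (Ordinal (ltnW ilt))).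
have S2 (i : 'I_n) : \sum_(j : 'I_n | j.+2 == i) Z j = if (i < 2)%N then 0 else Y i.
  case: i => [[|[|i]] ilt] /=; [by rewrite big_pred0..|].
  by rewrite (big_pred1 (Ordinal (ltnW (ltnW ilt)))).
(* Since Z solves the recursion, only the equations that involve the initial
   data contribute to L Z. *)
have LZ i : \sum_j L i j *m Z j =
    (if (i < 2)%N then b i *m Y i else 0)
    - (if i == 0 :> nat then a i.+1 *m Y i.+1 else 0).
  under eq_bigr do rewrite !mulmxBl.
  rewrite !sumrB !sum_if_mul big_pred1_eq Yrec // S1 S2.
  case: i => [[|[|i]]] ilt /=; rewrite ?subr0 ?mulmx0.
  - by rewrite sub0r subr0 opprB.
  - by rewrite subr0 opprB addrC subrK.
  - by rewrite opprB addrCA subrr addr0 ?subrr.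
have LZD : bmx hill_shift = bmx L *m (1%:M - bcol Z *m brow D).
  rewrite mulmxBr mulmx1 mulmxA mul_bmx_bcol mul_bcol_brow.
  rewrite bmxB; apply: eq_bmx => i j; rewrite LZ.
  have Y0D : Y 0%N *m D j = if j.+2 == 0 %[mod n] then 1%:M else 0.
    by rewrite Y0 mul_row_col mul1mx mul0mx addr0.
  have Y1D : Y 1%N *m D j = if j.+1 == n then 1%:M else 0.
    by rewrite Y1 mul_row_col mul1mx mul0mx add0r.
  rewrite /hill_shift /L mulmxBl.
  have Sj0 : (j.+1 == 0 %[mod n]) = (j.+1 == n).
    have := ltn_ord j; rewrite leq_eqVlt => /orP[/eqP->|jn].
      by rewrite modnn mod0n !eqxx.
    by rewrite modn_small // mod0n (ltn_eqF jn).
  have SSj1 : (1 < n)%N -> (j.+2 == 1 %[mod n]) = (j.+1 == n).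
    by move=> n1; rewrite -Sj0 -addn1 -[in RHS](eqn_modDr 1).
  have SjE r : (0 < r < n)%N -> (j.+1 == r %[mod n]) = (j.+1 == r).
    case/andP=> r0 rn; rewrite (modn_small rn).
    have := ltn_ord j; rewrite leq_eqVlt => /orP[/eqP->|jn].
      by rewrite modnn ltn_eqF // gtn_eqF.
    by rewrite modn_small.
  have SSjE r : (1 < r < n)%N -> (j.+2 == r %[mod n]) = (j.+2 == r).
    case: r => // r /andP[r0 rn].
    rewrite -addn1 -(addn1 r) eqn_modDr !addn1 eqSS SjE //.
    by rewrite -ltnS r0 ltnW.
  case: i => [[|[|i]]] ilt /=.
  - rewrite -!mulmxA Y0D Y1D Sj0 !(fun_if (fun X => _ *m X)) !mulmx1 !mulmx0.
    by rewrite !subr0 sub0r opprB addrCA addrA.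
  - rewrite mul0mx subr0 -mulmxA Y1D SSj1 // SjE //.
    by rewrite (fun_if (fun X => _ *m X)) mulmx1 mulmx0 subr0.
  - by rewrite !mul0mx !subr0 SjE // SSjE.
rewrite LZD det_mulmx det_1subC mul_brow_bcol; congr (_ * _).
  rewrite det_bmx_trig => [|i j ij].
    apply: eq_bigr => i _; congr (\det _); rewrite /L eqxx.
    by rewrite !gtn_eqF //= ?sub0r ?subr0.
  by rewrite /L -val_eqE /= !gtn_eqF ?subr0 // ltnW // ltnW.
have -> : \sum_j D j *m Z j = col_mx (\sum_(j < n | j.+2 == 0 %[mod n]) Z j)
                                     (\sum_(j < n | j.+1 == n) Z j).
  have sumZ (p : pred 'I_n) :
      \sum_(j | p j) Z j = \sum_j (if p j then 1%:M else 0) *m Z j.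
    by rewrite sum_if_mul mul1mx.
  rewrite !sumZ -[LHS]vsubmxK; congr col_mx; rewrite linear_sum.
    by apply: eq_bigr => j _; rewrite /= mul_col_mx col_mxKu.
  by apply: eq_bigr => j _; rewrite /= mul_col_mx col_mxKd.
have predn_lt : (n.-1 < n)%N by rewrite prednK.
have -> : \sum_(j < n | j.+1 == n) Z j = Y n.+1.
  rewrite (big_pred1 (Ordinal predn_lt)) => [|j].
    by rewrite /Z /= prednK.
  by rewrite /= -val_eqE /= -[in RHS]eqSS prednK.
(* If n = 1 there is a single block, both blocks of D Z are Y_2, and the first
   one differs from Y_n = Y_1 by a row operation on 1 - D Z. *)
have [n_le1|n_gt1] := leqP n 1.
  have n1 : n = 1%N by apply/eqP; rewrite eqn_leq n_le1.
  rewrite (big_pred1 (Ordinal predn_lt)) => [|j]; last first.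
    have modn0 x : (x %% n)%N = 0%N by rewrite n1 modn1.
    have pred0 : n.-1 = 0%N by rewrite n1.
    rewrite /= -val_eqE /= !modn0 pred0 eqxx; symmetry; rewrite -leqn0 -{1}pred0.
    by rewrite -ltnS prednK // ltn_ord.
  rewrite /Z /= !n1 /=.
  have E U : (1%:M : 'M[F]_(d + d)) - U = col_mx (Y 0%N) (Y 1%N) - U.
    by rewrite Y0 Y1 [1%:M]scalar_mx_block.
  rewrite !E !opp_col_mx !add_col_mx.
  have -> : col_mx (Y 0%N - Y 2) (Y 1%N - Y 2) =
    block_mx 1%:M 1%:M 0 1%:M *m col_mx (Y 0%N - Y 1%N) (Y 1%N - Y 2).
    by rewrite mul_block_col !mul1mx mul0mx add0r addrA subrK.
  by rewrite det_mulmx det_ublock !det1 !mul1r.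
congr (\det (_ - _)); congr col_mx.
have n2 : (n.-2 < n)%N by rewrite (leq_ltn_trans (leq_pred _)).
rewrite (big_pred1 (Ordinal n2)) => [|j].
  by rewrite /Z /= -!subn1 -subnDA subn2 !prednK // -ltnS prednK.
rewrite /= -val_eqE /= mod0n; have jn := ltn_ord j.
case: (ltngtP j.+2 n) => [jn2|jn1|jn2].
- by rewrite modn_small //; lia.
- have -> : j.+2 = (1 + n)%N by lia.
  by rewrite modnDr modn_small //; lia.
by rewrite jn2 modnn; lia.
Qed.

Lemma det_hill_mx :
  \det (bmx hill_mx) = (-1) ^+ (n * d + d) *
    \prod_(i < n) \det (- (b i.+1)^T) * \det (1%:M - col_mx (Y n) (Y n.+1)).
Proof.
by rewrite (eq_bmx hill_mxE) det_bmx_shift // det_hill_shift mulrA.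
Qed.

(** The matrix of the operator (B y)_i = - b_(i-1) y_(i-1), with the same
    numbering of the blocks. *)
Definition shift_mx (i j : 'I_n) : 'M[F]_d :=
  - (if j.+1 == i %[mod n] then b i else 0).

Lemma det_shift_mx : b n = b 0%N ->
  \det (bmx shift_mx) = (-1) ^+ (n * d + d) * \prod_(i < n) \det (- (b i.+1)^T).
Proof.
move=> bper; rewrite -[LHS]det_tr.
(* Up to the shift of its columns, the transposed matrix is block diagonal, with
   the same diagonal blocks as the triangular part of [hill_shift]. *)
pose G (i l : 'I_n) : 'M[F]_d := if l == i then - (b i.+1)^T else 0.
have <- : bmx (fun i j => G i (ord_pred j)) = (bmx shift_mx)^T.
  apply/matrixP => s t; rewrite !mxE.
  case: (enum_val s) (enum_val t) => [i u] [j v] /=.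
  rewrite /G /shift_mx -(inj_eq (can_inj (@ordSK n))) ord_predK.
  rewrite eq_sym -val_eqE /=.
  rewrite [(j %% n)%N]modn_small //.
  case: eqP => [ij|_]; last by rewrite !mxE oppr0.
  have -> : b i.+1 = b j.
    have := ltn_ord i; rewrite leq_eqVlt => /orP[/eqP iE|i_lt].
      by rewrite iE bper -ij iE modnn.
    by rewrite -ij modn_small.
  by rewrite !mxE.
rewrite det_bmx_shift // det_bmx_trig => [|i j ij].
  by congr (_ * _); apply: eq_bigr => i _; rewrite /G eqxx.
by rewrite /G -val_eqE gtn_eqF.
Qed.

Lemma det_shift_mxE : b n = b 0%N ->
  \det (bmx shift_mx) = (-1) ^+ d * \prod_(i < n) \det (b i.+1).
Proof.
move=> bper; rewrite det_shift_mx //.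
have -> : \prod_(i < n) \det (- (b i.+1)^T) =
    (-1) ^+ (n * d) * \prod_(i < n) \det (b i.+1).
  under eq_bigr do rewrite -scaleN1r detZ det_tr.
  by rewrite big_split /= prodr_const card_ord -exprM mulnC.
rewrite mulrA -exprD; congr (_ * _).
by rewrite -[LHS]signr_odd -[RHS]signr_odd !oddD addbAC addbb.
Qed.

Lemma hill_formula : b n = b 0%N ->
  \det (bmx hill_mx) =
  \det (bmx shift_mx) * \det (1%:M - col_mx (Y n) (Y n.+1)).
Proof. by move=> bper; rewrite det_hill_mx det_shift_mx. Qed.

End Hill.
End Det.

(** * Reduction of a linear system by isotropic trajectories *)

(** In this section the columns of W_i are k trajectories at the index i,
    those of Q_i are a basis of E_i^perp, and an operator T : E_i -> E_j^* is
    the matrix such that <T u, v> = v^T T u. Trajectories are matrix valued,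
    which amounts to dealing with several trajectories at once. *)
Section ReducedSystem.
Variables (F : fieldType) (m k d : nat).
Variables (A B : int -> 'M[F]_m).
Variables (W : int -> 'M[F]_(m, k)) (Q : int -> 'M[F]_(m, d)).

(** The columns of u are trajectories of the linear system. *)
Definition mx_traj q (u : int -> 'M[F]_(m, q)) := forall i,
  A i *m u i - B (i - 1) *m u (i - 1) - (B i)^T *m u (i + 1) = 0.

(** The Gram matrix G_i, the operator C_i, and the operators A_i^perp and
    B_i^perp in the bases Q_i. *)
Definition gram i := (W i)^T *m (B i)^T *m W (i + 1).
Definition mxC i : 'M[F]_m :=
  (B i)^T *m W (i + 1) *m invmx (gram i) *m (W (i + 1))^T *m B i.
Definition reda i := (Q i)^T *m (A i - mxC i) *m Q i.
Definition redb i := (Q (i + 1))^T *m B i *m Q i.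

Hypothesis A_sym : forall i, (A i)^T = A i.
Hypothesis B_unit : forall i, B i \in unitmx.
Hypothesis W_traj : mx_traj W.

(** The matrix of the symplectic products of the columns of W with those of u,
    computed at the index i. *)
Definition mxomega q (u : int -> 'M[F]_(m, q)) i :=
  (W i)^T *m (B i)^T *m u (i + 1) - (W (i + 1))^T *m B i *m u i.

(** The pairing of the equation of u with W_i, and of that of W with u_i, have
    the same term in A_i because A_i is symmetric. *)
Lemma mxomega_prev q (u : int -> 'M[F]_(m, q)) i :
  mx_traj u -> mxomega u (i - 1) = mxomega u i.
Proof.
move=> u_traj; rewrite /mxomega subrK.
have E1 := congr1 (mulmx (W i)^T) (u_traj i).
have E2 := congr1 (fun X => X^T *m u i) (W_traj i).
have trB p p' (X X' : 'M[F]_(p, p')) : (X - X')^T = X^T - X'^T.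
  by apply/matrixP => s t; rewrite !mxE.
move: E1 E2; rewrite /= !trB !trmx_mul !trmxK A_sym !mulmxBl !mulmxBr.
rewrite !mulmxA mulmx0 trmx0 mul0mx.
set a := _ *m A i *m _; set b := (W i)^T *m B (i - 1) *m _.
set c := (W i)^T *m (B i)^T *m _; set b' := (W (i - 1))^T *m _ *m _.
set c' := _ *m B i *m _.
move=> /eqP; rewrite -addrA -opprD subr_eq0 => /eqP ->.
move/eqP; rewrite -addrA -opprD subr_eq0 => /eqP E.
by apply/eqP; rewrite subr_eq addrAC eq_sym subr_eq addrC -E addrC.
Qed.

Lemma mxomega_const q (u : int -> 'M[F]_(m, q)) i :
  mx_traj u -> mxomega u i = mxomega u 0.
Proof.
move=> u_traj; elim/int_ind: i => [//|i IH|i IH].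
  by rewrite -(mxomega_prev _ u_traj) -IH; congr (mxomega u _); lia.
by rewrite -IH -[RHS](mxomega_prev _ u_traj); congr (mxomega u _); lia.
Qed.

Hypothesis W_isotropic : mxomega W 0 = 0.
Hypothesis gram_unit : forall i, gram i \in unitmx.

Lemma gram_sym i : (gram i)^T = gram i.
Proof.
have := mxomega_const i W_traj; rewrite W_isotropic => /eqP.
by rewrite subr_eq0 /gram !trmx_mul !trmxK !mulmxA => /eqP ->.
Qed.

Lemma gramE i : (W (i + 1))^T *m B i *m W i = gram i.
Proof. by rewrite -[RHS]gram_sym /gram !trmx_mul !trmxK !mulmxA. Qed.

(* The columns of Q_i form a basis of E_i^perp. *)
Hypothesis Q_mem : forall i, (W (i - 1))^T *m (B (i - 1))^T *m Q i = 0.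
Hypothesis Q_span : forall i (u : 'cV[F]_m),
  (W (i - 1))^T *m (B (i - 1))^T *m u = 0 -> exists y, u = Q i *m y.
Hypothesis Q_inj : forall i (y : 'cV[F]_d), Q i *m y = 0 -> y = 0.

Lemma Q_memD i : (W i)^T *m (B i)^T *m Q (i + 1) = 0.
Proof. by have := Q_mem (i + 1); rewrite addrK. Qed.

Lemma Q_memT i : (Q i)^T *m B (i - 1) *m W (i - 1) = 0.
Proof.
by have := congr1 trmx (Q_mem i); rewrite !trmx_mul !trmxK trmx0 mulmxA.
Qed.

Lemma unitmx_col p (X : 'M[F]_p) :
  (forall y : 'cV[F]_p, X *m y = 0 -> y = 0) -> X \in unitmx.
Proof.
move=> X_inj; rewrite -unitmx_tr -row_free_unit -kermx_eq0; apply/rowV0P => v.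
move=> /sub_kermxP vX; apply: trmx_inj; rewrite trmx0; apply: X_inj.
by rewrite -[X]trmxK -trmx_mul vX trmx0.
Qed.

Lemma gram_prev i : (W (i - 1))^T *m (B (i - 1))^T *m W i = gram (i - 1).
Proof. by rewrite /gram subrK. Qed.

(** The coefficients along W_i of the component of u in the span of W_i, for the
    decomposition of E_i as the sum of E_i^perp and this span. *)
Definition coefW i q (u : 'M[F]_(m, q)) :=
  invmx (gram (i - 1)) *m (W (i - 1))^T *m (B (i - 1))^T *m u.

Lemma Q_decomp i q (u : 'M[F]_(m, q)) :
  exists y, u = Q i *m y + W i *m coefW i u.
Proof.
have proj_mem j : exists y, col j (u - W i *m coefW i u) = Q i *m y.
  apply: Q_span; rewrite colE mulmxA mulmxBr [_ *m (W i *m _)]mulmxA gram_prev.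
  by rewrite /coefW !mulmxA mulmxV ?gram_unit // mul1mx subrr mul0mx.
have [y yE] := fin_all_exists proj_mem.
exists (\matrix_(s, j) y j s 0); apply/eqP; rewrite -subr_eq; apply/eqP.
apply/matrixP => s j.
transitivity (col j (u - W i *m coefW i u) s 0); first by rewrite [RHS]mxE.
by rewrite yE !mxE; apply: eq_bigr => l _; rewrite mxE.
Qed.

(** A functional that vanishes on E_i^perp and on W_i is zero, as these span
    E_i. *)
Lemma Q_dual i (f : 'cV[F]_m) :
  (Q i)^T *m f = 0 -> (W i)^T *m f = 0 -> f = 0.
Proof.
move=> Qf Wf; apply: trmx_inj; rewrite trmx0 -[LHS]mulmx1.
have fQ : f^T *m Q i = 0 by rewrite -[Q i]trmxK -trmx_mul Qf trmx0.
have fW : f^T *m W i = 0 by rewrite -[W i]trmxK -trmx_mul Wf trmx0.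
have [y ->] := Q_decomp i 1%:M.
by rewrite mulmxDr !mulmxA fQ fW !mul0mx addr0.
Qed.

(** If v is in E_i^perp and B_i v vanishes on E_(i+1)^perp, then v is a
    combination of the columns of W_i, and the only such vector in E_i^perp is
    zero. *)
Lemma redb_unit i : redb i \in unitmx.
Proof.
apply: unitmx_col => y; rewrite /redb -mulmxA; set v := Q i *m y => Qv.
pose c := invmx (gram i) *m (W (i + 1))^T *m B i *m v.
have Bv0 : B i *m (v - W i *m c) = 0.
  apply: (@Q_dual (i + 1)).
    have := Q_memT (i + 1); rewrite addrK => QW.
    by rewrite mulmxA mulmxBr [_ *m _ *m (W i *m c)]mulmxA QW mul0mx subr0.
  rewrite mulmxA mulmxBr [_ *m _ *m (W i *m c)]mulmxA gramE /c !mulmxA.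
  by rewrite mulmxV ?gram_unit // mul1mx subrr.
have {Bv0} vE : v = W i *m c.
  by apply/eqP; rewrite -subr_eq0 -[_ - _](mulKmx (B_unit i)) Bv0 mulmx0.
clearbody c.
have c0 : c = 0.
  have := congr1 (mulmx ((W (i - 1))^T *m (B (i - 1))^T)) vE.
  rewrite /v !mulmxA Q_mem mul0mx gram_prev => /esym gc.
  by rewrite -[c](mulKmx (gram_unit (i - 1))) gc mulmx0.
by apply: (@Q_inj i); rewrite -/v vE c0 mulmx0.
Qed.

Lemma trmx_redb i : (redb i)^T = (Q i)^T *m (B i)^T *m Q (i + 1).
Proof. by rewrite /redb !trmx_mul trmxK mulmxA. Qed.

Lemma redb_prev i : redb (i - 1) = (Q i)^T *m B (i - 1) *m Q (i - 1).
Proof. by rewrite /redb subrK. Qed.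

(** For a trajectory u that is symplectically orthogonal to W, the components
    y determine the increments of the coefficients c, hence determine u up to
    the addition of a combination of the trajectories W with constant
    coefficients. *)
Lemma coef_step q (u : int -> 'M[F]_(m, q)) (y : int -> 'M[F]_(d, q))
    (c : int -> 'M[F]_(k, q)) i :
  mx_traj u -> mxomega u 0 = 0 ->
  (forall j, u j = Q j *m y j + W j *m c j) ->
  c (i + 1) - c i = invmx (gram i) *m (W (i + 1))^T *m B i *m Q i *m y i.
Proof.
move=> u_traj; rewrite -(mxomega_const i u_traj) => om0 uE.
move: om0; rewrite /mxomega !uE !mulmxDr !mulmxA Q_memD mul0mx add0r.
rewrite gramE -/(gram i) => /eqP; rewrite subr_eq0 -subr_eq -mulmxBr => /eqP.
by move/(congr1 (mulmx (invmx (gram i)))); rewrite mulKmx ?gram_unit // !mulmxA.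
Qed.

(** The components in E_i^perp of such a trajectory solve the reduced system. *)
Lemma reduced_eq q (u : int -> 'M[F]_(m, q)) (y : int -> 'M[F]_(d, q))
    (c : int -> 'M[F]_(k, q)) i :
  mx_traj u -> mxomega u 0 = 0 ->
  (forall j, u j = Q j *m y j + W j *m c j) ->
  reda i *m y i - redb (i - 1) *m y (i - 1) - (redb i)^T *m y (i + 1) = 0.
Proof.
move=> u_traj om0 uE; have dc := coef_step i u_traj om0 uE.
have := congr1 (mulmx (Q i)^T) (u_traj i).
have := congr1 (fun X => (Q i)^T *m X *m c i) (W_traj i).
rewrite mulmx0 mul0mx !uE redb_prev trmx_redb /reda.
rewrite !mulmxBr !mulmxBl !mulmxDr !mulmxA !Q_memT !mul0mx ?subr0 ?addr0 mulmx0.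
have -> : (Q i)^T *m (B i)^T *m W (i + 1) *m invmx (gram i) *m (W (i + 1))^T
    *m B i *m Q i *m y i = (Q i)^T *m (B i)^T *m W (i + 1) *m (c (i + 1) - c i).
  by rewrite dc !mulmxA.
rewrite mulmxBr.
set a1 := _ *m A i *m Q i *m _; set a2 := _ *m A i *m W i *m _.
set b1 := _ *m Q (i - 1) *m _; set b2 := _ *m Q (i + 1) *m _.
set w1 := _ *m _ *m W (i + 1) *m c i; set w2 := _ *m _ *m W (i + 1) *m _.
move=> /eqP; rewrite subr_eq0 => /eqP -> <-.
by rewrite opprB opprD !addrA ![_ - w2 - _]addrAC.
Qed.

Lemma Q_injM i q (y : 'M[F]_(d, q)) : Q i *m y = 0 -> y = 0.
Proof.
move=> Qy; apply: trmx_inj; rewrite trmx0; apply/row_matrixP => j.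
rewrite -tr_col row0; apply: trmx_inj; rewrite trmxK trmx0; apply: (@Q_inj i).
by rewrite colE mulmxA Qy mul0mx.
Qed.

Lemma traj_exists q (u0 u1 : 'M[F]_(m, q)) :
  exists u, [/\ mx_traj u, u 0 = u0 & u 1 = u1].
Proof.
pose fwd := fix fwd (n : nat) := if n is n'.+1 then
  let: (v, v') := fwd n' in
  (v', invmx (B n'.+1%:Z)^T *m (A n'.+1%:Z *m v' - B n'%:Z *m v)) else (u0, u1).
pose bwd := fix bwd (n : nat) := if n is n'.+1 then
  let: (v, v') := bwd n' in
  (invmx (B (- n'.+1%:Z)) *m (A (- n'%:Z) *m v - (B (- n'%:Z))^T *m v'), v)
  else (u0, u1).
pose u i := match i with Posz n => (fwd n).1 | Negz n => (bwd n.+1).1 end.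
have u_bwd n : u (- n%:Z) = (bwd n).1.
  by case: n => [|n] //; rewrite -NegzE.
exists u; split=> // -[[|n]|n].
- have -> : 0%:Z - 1 = - 1%:Z by lia.
  by rewrite u_bwd /= oppr0 mulKVmx // subKr subrr.
- have -> : n.+1%:Z - 1 = n by lia.
  have -> : n.+1%:Z + 1 = n.+2 by lia.
  rewrite /u /=; case: (fwd n) => v v' /=.
  by rewrite mulKVmx ?unitmx_tr // subrr.
have -> : Negz n - 1 = - n.+2%:Z by lia.
have -> : Negz n + 1 = - n%:Z by lia.
rewrite NegzE !u_bwd.
have E : (bwd n.+2).1 = invmx (B (- n.+2%:Z)) *m
    (A (- n.+1%:Z) *m (bwd n.+1).1 - (B (- n.+1%:Z))^T *m (bwd n).1).
  by rewrite /=; case: (bwd n).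
by rewrite E mulKVmx // subKr subrr.
Qed.

(** The initial data (u_0, u_1) of a trajectory orthogonal to W with given
    components (y_0, y_1) and vanishing coefficient along W_0, as linear
    functions of (y_0, y_1). *)
Definition lift_fst := row_mx (Q 0) (0 : 'M[F]_(m, d)).
Definition lift_snd :=
  row_mx (W 1 *m invmx (gram 0) *m (W 1)^T *m B 0 *m Q 0) (Q 1).

(** The lifted initial data are symplectically orthogonal to W. *)
Lemma lift_omega : (W 0)^T *m (B 0)^T *m lift_snd = (W 1)^T *m B 0 *m lift_fst.
Proof.
rewrite /lift_fst /lift_snd !mul_mx_row mulmx0 -[in RHS]mulmxA.
have := Q_memD 0; have := gramE 0; rewrite !add0r => g -> //; congr row_mx.
by rewrite !mulmxA -[_ *m W 1]/(gram 0) mulmxV // mul1mx.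
Qed.

(** The lift is injective modulo the span of W. *)
Lemma lift_ker (z : 'cV[F]_(d + d)) (c : 'cV[F]_k) :
  lift_fst *m z = W 0 *m c -> lift_snd *m z = W 1 *m c -> z = 0.
Proof.
rewrite -[z]vsubmxK /lift_fst /lift_snd !mul_row_col mul0mx addr0.
move: (usubmx z) (dsubmx z) => z0 z1 z0E.
have c0 : c = 0.
  have := congr1 (mulmx ((W (0 - 1))^T *m (B (0 - 1))^T)) z0E.
  rewrite !mulmxA Q_mem mul0mx gram_prev => /esym gc.
  by rewrite -[c](mulKmx (gram_unit (0 - 1))) gc mulmx0.
rewrite c0 !mulmx0 in z0E *; have z00 := Q_inj z0E.
by rewrite z00 mulmx0 add0r => /Q_inj ->; rewrite col_mx0.
Qed.

(** Modulo the span of W, the lift is onto the initial data orthogonal to W. *)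
Lemma lift_decomp (u0 u1 : 'cV[F]_m) :
  (W 0)^T *m (B 0)^T *m u1 = (W 1)^T *m B 0 *m u0 ->
  exists z c, u0 = lift_fst *m z + W 0 *m c /\ u1 = lift_snd *m z + W 1 *m c.
Proof.
move=> om; have [y0 u0E] := Q_decomp 0 u0; set c := coefW 0 u0 in u0E.
clearbody c.
pose r := u1 - W 1 *m c -
  W 1 *m invmx (gram 0) *m (W 1)^T *m B 0 *m Q 0 *m y0.
have [y1 rE] : exists y1, r = Q 1 *m y1.
  apply: Q_span; rewrite subrr /r !mulmxBr om u0E mulmxDr !mulmxA.
  rewrite -[_ *m W 1]/(gram 0) mulmxV // mul1mx.
  have := gramE 0; rewrite add0r => ->.
  by rewrite addrK subrr.
exists (col_mx y0 y1), c.
rewrite /lift_fst /lift_snd !mul_row_col mul0mx addr0; split=> //.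
by rewrite -rE /r addrC [_ + (_ - _)]addrC subrK addrC subrK.
Qed.

Variable n : nat.
Hypothesis B_per : forall i, B (i + n%:Z) = B i.
Hypothesis W_per : forall i, W (i + n%:Z) = W i.
Hypothesis Q_per : forall i, Q (i + n%:Z) = Q i.

(** After one period, the trajectory with initial data the lift of (y_0, y_1)
    is, modulo W, the lift of the components (y_n, y_(n+1)) of the solution of
    the reduced system. *)
Lemma reduced_monodromy :
  exists (u : int -> 'M[F]_(m, d + d)) (Y : int -> 'M[F]_(d, d + d)) c,
  [/\ mx_traj u, u 0 = lift_fst, u 1 = lift_snd,
      [/\ Y 0 = row_mx 1%:M 0, Y 1 = row_mx 0 1%:M & forall i,
      reda i *m Y i - redb (i - 1) *m Y (i - 1) - (redb i)^T *m Y (i + 1) = 0]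
    & u n%:Z = lift_fst *m col_mx (Y n%:Z) (Y (n%:Z + 1)) + W 0 *m c /\
      u (n%:Z + 1) = lift_snd *m col_mx (Y n%:Z) (Y (n%:Z + 1)) + W 1 *m c].
Proof.
have [u [u_traj u0 u1]] := traj_exists lift_fst lift_snd.
have om0 : mxomega u 0 = 0 by rewrite /mxomega add0r u0 u1 lift_omega subrr.
have [Y YE] := boolp.choice (fun i => Q_decomp i (u i)).
pose c i := coefW i (u i).
have uE i : u i = Q i *m Y i + W i *m c i by exact: YE.
have c0 : c 0 = 0.
  rewrite /c u0 /coefW -!(mulmxA (invmx _)) /lift_fst mul_mx_row mulmx0 Q_mem.
  by rewrite row_mx0 mulmx0.
have Y0 : Y 0 = row_mx 1%:M 0.
  apply/eqP; rewrite -subr_eq0; apply/eqP; apply: (@Q_injM 0).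
  have := uE 0; rewrite c0 mulmx0 addr0 u0 mulmxBr => <-.
  by rewrite mul_mx_row mulmx1 mulmx0 subrr.
have Y1 : Y 1 = row_mx 0 1%:M.
  apply/eqP; rewrite -subr_eq0; apply/eqP; apply: (@Q_injM 1).
  rewrite mulmxBr -[Q 1 *m Y 1](addrK (W 1 *m c 1)) -uE u1.
  rewrite /c u1 /coefW -!(mulmxA (invmx _)) subrr lift_omega /lift_fst /lift_snd.
  rewrite !mul_mx_row !mulmx0 mulmx1 !mulmxA opp_row_mx add_row_mx subrr.
  by rewrite oppr0 addr0 subrr.
exists u, Y, (c n%:Z); split=> //.
  by split=> // i; apply: reduced_eq u_traj om0 uE.
have per0 T (X : int -> T) : (forall i, X (i + n%:Z) = X i) -> X n%:Z = X 0.
  by move=> X_per; rewrite -[n%:Z]add0r X_per.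
have per1 T (X : int -> T) :
    (forall i, X (i + n%:Z) = X i) -> X (n%:Z + 1) = X 1.
  by move=> X_per; rewrite addrC X_per.
split.
  by rewrite uE (per0 _ _ Q_per) (per0 _ _ W_per) mul_row_col mul0mx addr0.
rewrite uE (per1 _ _ Q_per) (per1 _ _ W_per) mul_row_col.
have := coef_step n%:Z u_traj om0 uE => /eqP; rewrite subr_eq => /eqP ->.
rewrite /gram (per0 _ _ B_per) (per0 _ _ W_per) (per0 _ _ Q_per).
rewrite (per1 _ _ W_per) mulmxDr !mulmxA addrA.
by rewrite [Q 1 *m _ + _]addrC.
Qed.
End ReducedSystem.

Local Open Scope classical_set_scope.
Local Open Scope ring_scope.

(** * Symmetry of second derivatives *)

Section Schwarz.
Variables (R : realType) (V : normedModType R).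

Lemma is_derive_line (f : V -> R) (x v : V) (t : R) :
  derivable f (x + t *: v) v ->
  is_derive t 1 (fun s : R => f (x + s *: v)) ('D_v f (x + t *: v)).
Proof.
have E : (fun h : R => h^-1 *: (f (x + (h *: 1 + t) *: v) - f (x + t *: v))) =
         (fun h : R => h^-1 *: (f (h *: v + (x + t *: v)) - f (x + t *: v))).
  apply/funext => h; rewrite [h *: 1]mulr1 scalerDl.
  by rewrite addrCA.
by move=> df; apply: DeriveDef;
  [rewrite /derivable|rewrite /derive] => /=; rewrite E.
Qed.

Lemma MVT_from0 (g dg : R -> R) (h : R) : 0 < h ->
  (forall s, 0 <= s <= h -> is_derive s 1 g (dg s)) ->
  exists2 s, 0 <= s <= h & g h - g 0 = dg s * h.
Proof.
move=> h_gt0 gD.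
have [s||s sh ->] := MVT (f := g) (df := dg) h_gt0.
- by rewrite in_itv /= => /andP[s0 sh]; apply: gD; rewrite !ltW.
- apply: derivable_within_continuous => s; rewrite in_itv /= => sh.
  by have [] := gD s sh.
exists s; last by rewrite subr0.
by move: sh; rewrite in_itv /= => /andP[s0 sh]; rewrite !ltW.
Qed.

(** The second difference of f on a parallelogram is a value of the second
    derivative; the roles of v and w can be exchanged. *)
Lemma second_difference (U : set V) (f : V -> R) (x v w : V) (h : R) :
  C2_on U f -> 0 < h ->
  (forall s t, 0 <= s <= h -> 0 <= t <= h -> U (x + s *: v + t *: w)) ->
  exists s t, [/\ 0 <= s <= h, 0 <= t <= h &
    f (x + h *: v + h *: w) - f (x + h *: v) - f (x + h *: w) + f x =
    'D_w ('D_v f) (x + s *: v + t *: w) * h * h].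
Proof.
move=> fC2 h_gt0 subU.
have h0 : 0 <= (0 : R) <= h by rewrite lexx ltW.
have hh : 0 <= h <= h by rewrite lexx ltW.
pose phi s := f (x + h *: w + s *: v) - f (x + s *: v).
pose dphi s := 'D_v f (x + h *: w + s *: v) - 'D_v f (x + s *: v).
have phiD s : 0 <= s <= h -> is_derive s 1 phi (dphi s).
  move=> sh; apply: is_deriveB; apply: is_derive_line.
    by rewrite addrAC; have [_ /(_ v)[]] := fC2 _ (subU s h sh hh).
  rewrite -[_ + _]addr0 -(scale0r w).
    by have [_ /(_ v)[]] := fC2 _ (subU s 0 sh h0).
have [s sh phiE] := MVT_from0 h_gt0 phiD.
pose psi t := 'D_v f (x + s *: v + t *: w).
have psiD t : 0 <= t <= h ->
    is_derive t 1 psi ('D_w ('D_v f) (x + s *: v + t *: w)).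
  move=> th; apply: is_derive_line.
  by have [_ /(_ v)[_ _ /(_ w)[]]] := fC2 _ (subU s t sh th).
have [t th psiE] := MVT_from0 h_gt0 psiD.
exists s, t; split => //.
have psi_dphi : psi h - psi 0 = dphi s.
  by rewrite /psi /dphi scale0r addr0 [x + s *: v + _]addrAC.
rewrite -psiE psi_dphi -phiE /phi !scale0r !addr0.
rewrite [x + h *: w + _]addrAC opprB addrA.
by rewrite [RHS]addrAC.
Qed.

(** Schwarz's theorem. *)
Lemma C2_derive_comm (U : set V) (f : V -> R) (x v w : V) :
  open U -> C2_on U f -> U x -> 'D_w ('D_v f) x = 'D_v ('D_w f) x.
Proof.
move=> Uo fC2 Ux; apply/eqP; rewrite -subr_eq0 -normr_le0.
apply/ler_addgt0Pr => e e_gt0.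
rewrite add0r.
have e2 : 0 < e / 2 by rewrite divr_gt0.
have cont a b : {for x, continuous ('D_b ('D_a f))}.
  by have [_ /(_ a)[_ _ /(_ b)[]]] := fC2 _ Ux.
have near_x : \forall y \near x, [/\ U y,
    `|'D_w ('D_v f) x - 'D_w ('D_v f) y| < e / 2 &
    `|'D_v ('D_w f) x - 'D_v ('D_w f) y| < e / 2].
  have n1 : \forall y \near x, U y by exact: open_nbhs_nbhs.
  have n2 : \forall y \near x, `|'D_w ('D_v f) x - 'D_w ('D_v f) y| < e / 2.
    by have /cvgrPdist_lt := cont v w; apply.
  have n3 : \forall y \near x, `|'D_v ('D_w f) x - 'D_v ('D_w f) y| < e / 2.
    by have /cvgrPdist_lt := cont w v; apply.
  by apply: filterS3 n1 n2 n3.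
have [r r_gt0 hr] : exists2 r : R, 0 < r &
    forall s t, 0 <= s <= r -> 0 <= t <= r ->
   [/\ U (x + s *: v + t *: w),
    `|'D_w ('D_v f) x - 'D_w ('D_v f) (x + s *: v + t *: w)| < e / 2 &
    `|'D_v ('D_w f) x - 'D_v ('D_w f) (x + s *: v + t *: w)| < e / 2].
  have line_cvg :
      (fun p : R * R => x + p.1 *: v + p.2 *: w) @ (0 : R, 0 : R) --> x.
    rewrite -[X in _ --> X]addr0 -(scale0r w) -[X in X + _]addr0 -{1}(scale0r v).
    apply: cvgD; first apply: cvgD; first exact: cvg_cst.
      by apply: cvgZr_tmp; exact: cvg_fst.
    by apply: cvgZr_tmp; exact: cvg_snd.
  have [[A B] /= [/nbhs_ballP[r1 r1_gt0 hA] /nbhs_ballP[r2 r2_gt0 hB]] AB] :=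
    line_cvg _ near_x.
  have r_gt0 : 0 < Num.min r1 r2 by rewrite lt_min r1_gt0.
  have small r' s : 0 < r' -> Num.min r1 r2 <= r' ->
      0 <= s <= Num.min r1 r2 / 2 -> ball (0 : R) r' s.
    move=> r'_gt0 rr' /andP[s0 sr]; rewrite -ball_normE /= sub0r normrN ger0_norm //.
    apply: le_lt_trans sr _; apply: lt_le_trans rr'.
    by rewrite ltr_pdivrMr // ltr_pMr // ltr1n.
  exists (Num.min r1 r2 / 2); first by rewrite divr_gt0.
  move=> s t hs ht; apply: (AB (s, t)); split.
    by apply: hA; apply: small => //; rewrite ge_min lexx.
  by apply: hB; apply: small => //; rewrite ge_min lexx orbT.
have [s [t [hs ht E1]]] : exists s t, [/\ 0 <= s <= r, 0 <= t <= r &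
    f (x + r *: v + r *: w) - f (x + r *: v) - f (x + r *: w) + f x =
    'D_w ('D_v f) (x + s *: v + t *: w) * r * r].
  by apply: second_difference fC2 r_gt0 _ => s t hs ht; have [] := hr s t hs ht.
have [t' [s' [ht' hs' E2]]] : exists t s, [/\ 0 <= t <= r, 0 <= s <= r &
    f (x + r *: w + r *: v) - f (x + r *: w) - f (x + r *: v) + f x =
    'D_v ('D_w f) (x + t *: w + s *: v) * r * r].
  apply: second_difference fC2 r_gt0 _ => t' s' ht' hs'.
  by rewrite addrAC; have [] := hr s' t' hs' ht'.
have close (a b p q D : R) : D = p * r * r -> D = q * r * r ->
    `|a - p| < e / 2 -> `|b - q| < e / 2 -> `|a - b| <= e.
  move=> -> /eqP; rewrite -!mulrA; have q_gt0 : 0 < r * r by rewrite mulr_gt0.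
  rewrite (inj_eq (mulIf (lt0r_neq0 q_gt0))) => /eqP -> h1 h2.
  rewrite (le_trans (ler_distD q _ _)) // [leRHS]splitr lerD // ?ltW //.
  by rewrite distrC.
have E3 : f (x + r *: v + r *: w) - f (x + r *: v) - f (x + r *: w) + f x =
    'D_v ('D_w f) (x + s' *: v + t' *: w) * r * r.
  by rewrite [x + s' *: v + _]addrAC -[RHS]E2 [x + r *: w + _]addrAC (addrAC (f _)).
have [_ h1 _] := hr s t hs ht; have [_ _ h2] := hr s' t' hs' ht'.
exact: close E1 E3 h1 h2.
Qed.

End Schwarz.

(** * The linearized system *)

Section Linearization.
Variables (R : realType) (m n : nat) (M : topologicalType).
Variables (atl : set (chart R m M)) (L : M -> M -> R).
Variables (x : int -> M) (phi : int -> chart R m M).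
Hypothesis mfdM : is_manifold atl.
Hypothesis L_C2 : C2_lagrangian L atl.
Hypothesis phi_atl : forall i, atl (phi i).
Hypothesis phi_x : forall i, chart_dom (phi i) (x i).

Lemma Lloc_derive_comm i v w :
  'D_w ('D_v (Lloc L phi i)) (zloc phi x i) =
  'D_v ('D_w (Lloc L phi i)) (zloc phi x i).
Proof.
have [_ _ [chartP _ _]] := mfdM.
apply: (@C2_derive_comm _ _ (chart_img (phi i) `*` chart_img (phi (i + 1)))).
- have [_ Uo _ _ _] := chartP _ (phi_atl i).
  have [_ Uo' _ _ _] := chartP _ (phi_atl (i + 1)).
  rewrite openE => -[y z] [Uy U'z].
  exists (chart_img (phi i), chart_img (phi (i + 1))) => //=.
  by split; exact: open_nbhs_nbhs.
- exact: L_C2.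
- by split; [exists (x i)|exists (x (i + 1))].
Qed.

Lemma linearization_opA_sym i :
  (opA (linearization L phi x) i)^T = opA (linearization L phi x) i.
Proof.
apply/matrixP => a b; rewrite !mxE.
exact: (congr2 +%R
  (Lloc_derive_comm (i - 1) (0, delta_mx b 0) (0, delta_mx a 0))
  (Lloc_derive_comm i (delta_mx b 0, 0) (delta_mx a 0, 0))).
Qed.

Hypothesis x_per : nperiodic n x.
Hypothesis phi_per : nperiodic n phi.

Let Lloc_per i : Lloc L phi (i + n%:Z) = Lloc L phi i.
Proof. by rewrite /Lloc addrAC !phi_per. Qed.

Let zloc_per i : zloc phi x (i + n%:Z) = zloc phi x i.
Proof. by rewrite /zloc addrAC !phi_per !x_per. Qed.

Lemma linearization_opB_per : nperiodic n (opB (linearization L phi x)).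
Proof.
pose T (f : 'cV[R]_m * 'cV[R]_m -> R) z : 'M[R]_m := \matrix_(a, b)
  - 'D_(delta_mx b 0, 0) ('D_(0, delta_mx a 0) f) z.
move=> i; rewrite -[LHS]/(T (Lloc L phi (i + n%:Z)) (zloc phi x (i + n%:Z))).
by rewrite (Lloc_per i) (zloc_per i).
Qed.

End Linearization.

Local Close Scope classical_set_scope.

(** * Determinants and operators in matrix form *)

Section DetEnd.
Import passmx.

(** A linear bijection J identifies f with the matrix N, hence their
    determinants. *)
Lemma det_end_intertwine (K : fieldType) (U : vectType K) (f : 'End(U)) p
    (N : 'M[K]_p) (J : {linear 'cV[K]_p -> U}) :
  (forall z, J z = 0 -> z = 0) -> (forall v, exists z, J z = v) ->
  (forall z, f (J z) = J (N *m z)) -> det_end f = \det N.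
Proof.
move=> J_inj J_surj fJ; rewrite /det_end -[RHS]det_tr; symmetry.
set b := vbasis {:U}; have b_basis : basis_of fullv b by exact: vbasisP.
have [g gK] := boolp.choice J_surj.
pose X := \matrix_s rVof b (J (delta_mx s 0)).
pose Y := \matrix_j (g (vecof b (delta_mx 0 j)))^T.
have XE (z : 'cV[K]_p) : z^T *m X = rVof b (J z).
  rewrite -[z in RHS]trmxK [z^T in RHS]row_sum_delta mulmx_sum_row.
  rewrite !linear_sum; apply: eq_bigr => s _.
  by rewrite rowK /= !linearZ /= trmx_delta.
have YX : Y *m X = 1%:M.
  by apply/row_matrixP => j; rewrite row_mul rowK XE gK vecofK // row1.
have XY : X *m Y = 1%:M.
  apply/row_matrixP => s; rewrite row1 -[LHS]trmxK -[RHS]trmxK; congr (_^T).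
  apply/eqP; rewrite -subr_eq0; apply/eqP; apply: J_inj.
  rewrite linearB /=; apply/eqP; rewrite subr_eq0; apply/eqP.
  apply: (can_inj (rVofK b_basis)).
  by rewrite -!XE !trmxK -row_mul -mulmxA YX mulmx1 rowE.
apply: (det_intertwine XY YX).
apply/row_matrixP => s; rewrite !row_mul rowK rowE.
by rewrite -rVof_app // fJ -XE trmx_mul trmx_delta.
Qed.

End DetEnd.

Section Forms.
Variables (R : realType) (m k d : nat) (Lam : linear_system R m).
Variables (w : 'I_k -> int -> 'cV[R]_m) (e : int -> d.-tuple 'cV[R]_m).
Local Notation A := (opA Lam).
Local Notation B := (opB Lam).

(** The vectors w_i^a, and those of the basis e_i, as the columns of a matrix. *)
Definition Wmx (i : int) : 'M[R]_(m, k) := \matrix_(r, a) w a i r 0.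
Definition Qmx (i : int) : 'M[R]_(m, d) := \matrix_(r, a) tnth (e i) a r 0.

Lemma col_Wmx i a : col a (Wmx i) = w a i.
Proof. by apply/colP => r; rewrite !mxE. Qed.

Lemma col_Qmx i a : col a (Qmx i) = tnth (e i) a.
Proof. by apply/colP => r; rewrite !mxE. Qed.

Lemma mul_trcol p q (X : 'M[R]_(m, p)) (Y : 'M[R]_(m, q)) a b :
  (X^T *m Y) a b = ((col a X)^T *m col b Y) 0 0.
Proof. by rewrite !mxE; apply: eq_bigr => r _; rewrite !mxE. Qed.

Lemma mul_trcol3 p q (X : 'M[R]_(m, p)) (T : 'M[R]_m) (Y : 'M[R]_(m, q)) a b :
  (X^T *m T *m Y) a b = ((col a X)^T *m T *m col b Y) 0 0.
Proof. by rewrite -!mulmxA mul_trcol !colE !mulmxA. Qed.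

Lemma pairing_mul (T : 'M[R]_m) u v :
  pairing (T *m u) v = (u^T *m T^T *m v) 0 0.
Proof. by rewrite /pairing trmx_mul. Qed.

Lemma pairing_mulr (T : 'M[R]_m) u v :
  pairing (T *m u) v = (v^T *m T *m u) 0 0.
Proof.
rewrite pairing_mul; transitivity ((u^T *m T^T *m v)^T 0 0).
  by rewrite [RHS]mxE.
by rewrite !trmx_mul !trmxK mulmxA.
Qed.

Lemma matG_gram i : matG Lam w i = gram B Wmx i.
Proof.
by apply/matrixP => a b; rewrite mxE /gram mul_trcol3 !col_Wmx pairing_mul.
Qed.

Lemma mul_trcolv p (X : 'M[R]_(m, p)) (T : 'M[R]_m) (u : 'cV[R]_m) a :
  (X^T *m T *m u) a 0 = ((col a X)^T *m T *m u) 0 0.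
Proof.
by rewrite mul_trcol3; congr ((_ *m _) 0 0); apply/colP => r; rewrite mxE.
Qed.

Lemma Eperp_mx i u :
  u \in Eperp Lam w i <-> (Wmx (i - 1))^T *m (B (i - 1))^T *m u = 0.
Proof.
split=> [/EperpP uE|uE].
  by apply/colP => a; rewrite mul_trcolv col_Wmx -pairing_mul uE mxE.
by apply/EperpP => a; rewrite pairing_mul -col_Wmx -mul_trcolv uE mxE.
Qed.

Hypothesis e_basis : forall i, basis_of (Eperp Lam w i) (e i).

Lemma mul_Qmx i (y : 'cV[R]_d) : Qmx i *m y = \sum_a y a 0 *: (e i)`_a.
Proof.
apply/colP => r; rewrite summxE mxE; apply: eq_bigr => a _.
by rewrite !mxE mulrC (tnth_nth 0).
Qed.

Lemma Qmx_mem i : (Wmx (i - 1))^T *m (B (i - 1))^T *m Qmx i = 0.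
Proof.
apply/matrixP => s a; rewrite mul_trcol3 -mul_trcolv col_Qmx.
have /Eperp_mx -> : tnth (e i) a \in Eperp Lam w i.
  exact: basis_mem (e_basis i) (mem_tnth _ _).
by rewrite !mxE.
Qed.

Lemma Qmx_span i (u : 'cV[R]_m) :
  (Wmx (i - 1))^T *m (B (i - 1))^T *m u = 0 -> exists y, u = Qmx i *m y.
Proof.
move=> /Eperp_mx uE; exists (\col_a coord (e i) a u).
rewrite mul_Qmx [LHS](coord_basis (e_basis i) uE).
by apply: eq_bigr => a _; rewrite mxE.
Qed.

Lemma Qmx_inj i (y : 'cV[R]_d) : Qmx i *m y = 0 -> y = 0.
Proof.
rewrite mul_Qmx => y0; apply/colP => a; rewrite mxE.
by have /freeP/(_ (fun a => y a 0) y0 a) := basis_free (e_basis i).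
Qed.

Hypothesis G_sym : forall i, (gram B Wmx i)^T = gram B Wmx i.

Lemma quadC_mx i u :
  quadC Lam w i u = (u^T *m mxC B Wmx i *m u) 0 0.
Proof.
pose f : 'cV[R]_k := (Wmx (i + 1))^T *m B i *m u.
have fE a : pairing (B i *m u) (w a (i + 1)) = f a 0.
  by rewrite /f mul_trcolv col_Wmx pairing_mulr.
have -> : u^T *m mxC B Wmx i *m u = f^T *m invmx (gram B Wmx i) *m f.
  by rewrite /f /mxC !trmx_mul !trmxK !mulmxA.
clearbody f; rewrite /quadC matG_gram -mulmxA mxE; apply: eq_bigr => a _.
rewrite !mxE mulr_sumr; apply: eq_bigr => b _.
by rewrite !fE mulrCA mulrA.
Qed.

Lemma mxC_sym i : (mxC B Wmx i)^T = mxC B Wmx i.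
Proof. by rewrite /mxC !trmx_mul !trmxK trmx_inv G_sym !mulmxA. Qed.

Lemma Aperp_mx i u v :
  Aperp Lam w i u v = (v^T *m (A i - mxC B Wmx i) *m u) 0 0.
Proof.
rewrite /Aperp /Defs.formC !quadC_mx pairing_mulr mulmxBr mulmxBl [RHS]mxE.
congr (_ + _).
set C := mxC _ _ _; rewrite [RHS]mxE; congr (- _).
have C_sym : C^T = C by exact: mxC_sym.
clearbody C.
have uv : (u^T *m C *m v) 0 0 = (v^T *m C *m u) 0 0.
  transitivity ((u^T *m C *m v)^T 0 0); first by rewrite [RHS]mxE.
  by rewrite !trmx_mul trmxK C_sym mulmxA.
rewrite [(u + v)^T]linearD /= !mulmxDl !mulmxDr.
set p := u^T *m C *m u; set q := v^T *m C *m v.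
have addE (X Y : 'M[R]_1) : (X + Y) 0 0 = X 0 0 + Y 0 0 by rewrite mxE.
rewrite !addE uv; move: (p 0 0) (q 0 0) (_ 0 0) => p1 q1 x1.
by field.
Qed.

Section Entries.
Variable n : nat.

Let a_ (i : nat) := reda A B Wmx Qmx i%:Z.
Let b_ (i : nat) := redb B Qmx i%:Z.

Lemma basis_XperpE (i : 'I_n) a (j : nat) :
  basis_Xperp e (i, a) j%:Z =
  if j == i.+1 %[mod n] then col a (Qmx j%:Z) else 0.
Proof. by rewrite /basis_Xperp !modz_nat eqz_nat col_Qmx. Qed.

Lemma eq_modSS (i j : nat) : (i.+1 == j.+1 %[mod n]) = (i == j %[mod n]).
Proof. by rewrite -(addn1 i) -(addn1 j) eqn_modDr. Qed.

Lemma entry_if (c : bool) p q (X : 'M[R]_(m, p)) (T : 'M[R]_m)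
    (Y : 'M[R]_(m, q)) a b :
  ((col a X)^T *m T *m (if c then col b Y else 0)) 0 0 =
  (if c then X^T *m T *m Y else 0) a b.
Proof.
by case: c; [rewrite -mul_trcol3|rewrite mulmx0 !mxE].
Qed.

Lemma Hperp_entry (i j : 'I_n) a b :
  Hperp Lam w n (basis_Xperp e (j, b)) (basis_Xperp e (i, a)) =
  hill_mx a_ b_ i j a b.
Proof.
have comp0 v l : Hperp_comp Lam w v l 0 = 0.
  rewrite /Hperp_comp Aperp_mx /Bperp !pairing_mulr trmx0.
  by rewrite !mulmx0 !mul0mx !mxE !subr0.
rewrite /Hperp big_add1 big_mkord (bigD1 i) //= big1 ?addr0; last first.
  move=> l li; rewrite basis_XperpE eq_modSS !modn_small //.
  by rewrite (negPf (_ : _ != _)).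
rewrite basis_XperpE eqxx /Hperp_comp Aperp_mx /Bperp pairing_mul pairing_mulr.
have -> : i.+1%:Z - 1 = i%:Z by lia.
have i2 : i.+1%:Z + 1 = i.+2%:Z by lia.
rewrite i2 !basis_XperpE !entry_if !eq_modSS.
have -> : (i == j %[mod n]) = (i == j) by rewrite !modn_small.
rewrite /hill_mx !mxE [(i == j.+1 %[mod n])]eq_sym.
rewrite /a_ /b_ trmx_redb i2 /reda /redb.
have -> : i%:Z + 1 = i.+1%:Z by lia.
by [].
Qed.

Lemma boldBperp_entry (i j : 'I_n) a b :
  boldBperp Lam n (basis_Xperp e (j, b)) (basis_Xperp e (i, a)) =
  shift_mx b_ i j a b.
Proof.
have comp0 v l : Bperp_comp Lam v l 0 = 0.
  by rewrite /Bperp_comp /Bperp pairing_mulr trmx0 !mul0mx !mxE oppr0.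
rewrite /boldBperp big_add1 big_mkord (bigD1 i) //= big1 ?addr0; last first.
  move=> l li; rewrite basis_XperpE eq_modSS !modn_small //.
  by rewrite (negPf (_ : _ != _)).
rewrite basis_XperpE eqxx /Bperp_comp /Bperp pairing_mulr.
have -> : i.+1%:Z - 1 = i%:Z by lia.
rewrite basis_XperpE entry_if /shift_mx !mxE eq_sym.
rewrite /b_ /redb.
have -> : i%:Z + 1 = i.+1%:Z by lia.
by [].
Qed.

Lemma det_Hperp_bmx : det_Hperp Lam n w e = \det (bmx (@hill_mx _ n d a_ b_)).
Proof.
congr (\det _); apply/matrixP => s t; rewrite mxE [RHS]mxE.
by case: (enum_val s) (enum_val t) => [i a] [j b]; rewrite Hperp_entry.
Qed.

Lemma det_boldBperp_bmx :
  det_boldBperp Lam n e = \det (bmx (@shift_mx _ n d b_)).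
Proof.
congr (\det _); apply/matrixP => s t; rewrite mxE [RHS]mxE.
by case: (enum_val s) (enum_val t) => [i a] [j b]; rewrite boldBperp_entry.
Qed.

Lemma det_Bperp_mx i : det_Bperp Lam e i = \det (redb B Qmx i).
Proof.
rewrite /det_Bperp /det_form.
have id_bij : bijective (@id 'I_d) by exists id.
rewrite (@det_reindex _ _ _ _
  (fun s t => Bperp Lam i (tnth (e i) t) (tnth (e (i + 1)) s))
  _ _ (@enum_val_bij _) id_bij).
congr (\det _); apply/matrixP => s t; rewrite mxE /redb mul_trcol3 !col_Qmx.
exact: pairing_mulr.
Qed.

End Entries.
End Forms.

(** * The reduced Poincare map *)

Section Monodromy.
Variables (R : realType) (m k d : nat) (Lam : linear_system R m).
Variables (w : 'I_k -> int -> 'cV[R]_m).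
Local Notation A := (opA Lam).
Local Notation B := (opB Lam).
Local Notation W := (Wmx w).

Lemma mx_traj_col q (u : int -> 'M[R]_(m, q)) z :
  mx_traj A B u -> is_lin_trajectory Lam (fun i => u i *m z).
Proof.
by move=> u_traj i; rewrite !mulmxA -!mulmxBl u_traj mul0mx.
Qed.

Lemma Wmx_traj : (forall a, is_lin_trajectory Lam (w a)) -> mx_traj A B W.
Proof.
move=> w_traj i; apply: trmx_inj; rewrite trmx0; apply/row_matrixP => a.
rewrite row0 -tr_col -[RHS]trmx0; congr (_^T).
by rewrite !linearB /= !colE -!mulmxA -!colE !col_Wmx w_traj.
Qed.

Variable V : {vspace ('cV[R]_m * 'cV[R]_m)%type}.
Hypothesis w_basis : basis_of V [tuple (w a 0, w a 1) | a < k].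

Lemma mem_fix_space u :
  u \in V <-> exists c, u.1 = W 0 *m c /\ u.2 = W 1 *m c.
Proof.
pose X := [tuple (w a 0, w a 1) | a < k].
have sumE (c : 'cV[R]_k) : \sum_a c a 0 *: X`_a = (W 0 *m c, W 1 *m c).
  have XE (a : 'I_k) : X`_a = (w a 0, w a 1) by rewrite -tnth_nth tnth_mktuple.
  have WE i : W i *m c = \sum_a c a 0 *: w a i.
    apply/colP => r; rewrite summxE mxE; apply: eq_bigr => a _.
    by rewrite !mxE mulrC.
  rewrite !WE; elim/big_ind3: _ => // [x y [x1 x2] z t [z1 z2] -> ->|a _] //.
  by rewrite XE.
split=> [uV|[c [u1 u2]]].
  exists (\col_a coord X a u).
  suff uE : u = (W 0 *m \col_a coord X a u, W 1 *m \col_a coord X a u).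
    by split; [rewrite {1}uE|rewrite {1}uE].
  rewrite -sumE [LHS](coord_basis w_basis uV).
  by apply: eq_bigr => a _; rewrite mxE.
have -> : u = \sum_a c a 0 *: X`_a by rewrite sumE -u1 -u2; case: (u).
apply: memv_suml => a _; apply: memvZ; apply: basis_mem w_basis _.
by apply: mem_nth; rewrite size_tuple.
Qed.

Lemma omega_mx c u : omega Lam (W 0 *m c, W 1 *m c) u =
  (c^T *m ((W 0)^T *m (B 0)^T *m u.2 - (W 1)^T *m B 0 *m u.1)) 0 0.
Proof.
rewrite /omega /= pairing_mul pairing_mulr !trmx_mul mulmxBr !mulmxA.
by rewrite [RHS]mxE; congr (_ + _); rewrite [RHS]mxE.
Qed.

Lemma mem_omega_orth_mx u : u \in omega_orth Lam V <->
  (W 0)^T *m (B 0)^T *m u.2 = (W 1)^T *m B 0 *m u.1.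
Proof.
split=> [/omega_orthP uO|uO].
  apply/eqP; rewrite -subr_eq0; apply/eqP; apply/colP => a; rewrite [RHS]mxE.
  have /uO : (W 0 *m delta_mx a 0, W 1 *m delta_mx a (0 : 'I_1)) \in V.
    by apply/mem_fix_space; exists (delta_mx a 0).
  by rewrite omega_mx trmx_delta -rowE [LHS]mxE.
apply/omega_orthP => v /mem_fix_space[c [v1 v2]].
have -> : v = (W 0 *m c, W 1 *m c) by rewrite -v1 -v2; case: (v).
by rewrite omega_mx uO subrr mulmx0 mxE.
Qed.

Hypothesis V_isotropic : isotropic Lam V.

Lemma Wmx_isotropic : mxomega B W W 0 = 0.
Proof.
apply: trmx_inj; rewrite trmx0; apply/row_matrixP => b.
rewrite row0 -tr_col -[RHS]trmx0; congr (_^T).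
have /mem_omega_orth_mx : (w b 0, w b 1) \in omega_orth Lam V.
  apply/omega_orthP => v vV; apply: V_isotropic vV _.
  apply: basis_mem w_basis _.
  by apply/tnthP; exists b; rewrite tnth_mktuple.
rewrite /mxomega !linearB /= !colE -!mulmxA -!colE !col_Wmx add0r !mulmxA => ->.
by rewrite subrr.
Qed.

Hypothesis A_sym : forall i, (A i)^T = A i.
Hypothesis B_unit : forall i, B i \in unitmx.
Hypothesis w_traj : forall a, is_lin_trajectory Lam (w a).
Hypothesis G_unit : forall i, matG Lam w i \in unitmx.
Variable e : int -> d.-tuple 'cV[R]_m.
Hypothesis e_basis : forall i, basis_of (Eperp Lam w i) (e i).
Variable n : nat.
Hypothesis n_gt0 : (0 < n)%N.
Hypothesis B_per : nperiodic n B.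
Hypothesis w_per : forall a, nperiodic n (w a).
Hypothesis e_per : nperiodic n e.
Variable P : 'End(('cV[R]_m * 'cV[R]_m)%type).
Hypothesis P_poincare : is_poincare_map Lam n P.
Variables (Wt : vectType R) (prj : 'Hom(subvs_of (omega_orth Lam V), Wt)).
Hypothesis prj_quot : is_quotient_map V prj.
Variable Pt : 'End(Wt).
Hypothesis Pt_induced : is_induced_map prj P Pt.
Local Notation Q := (Qmx e).

Let W_traj := Wmx_traj w_traj.
Let gram_unit i : gram B W i \in unitmx.
Proof. by rewrite -matG_gram. Qed.
Let gram_symW := gram_sym A_sym W_traj Wmx_isotropic.
Let Q_mem := Qmx_mem e_basis.
Let Q_span := Qmx_span e_basis.
Let Q_inj := Qmx_inj e_basis.
Let redb_u := redb_unit A_sym B_unit W_traj Wmx_isotropic gram_unit Q_mem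
  Q_span Q_inj.

Lemma isotropic_sub : (V <= omega_orth Lam V)%VS.
Proof.
by apply/subvP => v vV; apply/omega_orthP => v' v'V; apply: V_isotropic.
Qed.

Let l0 := lift_fst Q.
Let l1 := lift_snd B W Q.
Let Vo := omega_orth Lam V.

Let lift_mem z : (l0 *m z, l1 *m z) \in Vo.
Proof.
apply/mem_omega_orth_mx; rewrite /= !mulmxA.
by rewrite (lift_omega A_sym W_traj Wmx_isotropic gram_unit Q_mem).
Qed.

(* J is a linear isomorphism from the pairs (y_0, y_1) to the quotient space. *)
Let J z : Wt := prj (vsproj Vo (l0 *m z, l1 *m z)).

Let J_linear : linear J.
Proof.
move=> a y z; rewrite /J -linearP; congr (prj _); rewrite -linearP.
by congr (vsproj _ _); rewrite !linearP.
Qed.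

HB.instance Definition _ := GRing.isLinear.Build R _ _ _ J J_linear.

Let prj_eq u v : u \in Vo -> v \in Vo -> u - v \in V ->
  prj (vsproj Vo u) = prj (vsproj Vo v).
Proof.
move=> uV vV uvV; apply/eqP; rewrite -subr_eq0 -!linearB; apply/eqP.
by apply/prj_quot.2; rewrite vsprojK // memvB.
Qed.

Let J_inj z : J z = 0 -> z = 0.
Proof.
move/prj_quot.2; rewrite vsprojK // => /mem_fix_space[c /= [z0 z1]].
exact: (lift_ker gram_unit Q_mem Q_inj z0 z1).
Qed.

Let J_surj v : exists z, J z = v.
Proof.
have : v \in limg prj by rewrite prj_quot.1 memvf.
case/memv_imgP => u _ ->; have /mem_omega_orth_mx uO := valP u.
have [z [c [u0 u1]]] :=
  lift_decomp A_sym W_traj Wmx_isotropic gram_unit Q_span uO.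
exists z; rewrite /J -[u in RHS]vsvalK; apply: prj_eq => //; first exact: valP.
apply/mem_fix_space; exists (- c); rewrite /= u0 u1 !mulmxN.
by rewrite !opprD !addrA !subrr !sub0r.
Qed.

Let Q_per i : Q (i + n%:Z) = Q i.
Proof. by apply/matrixP => r a; rewrite !mxE e_per. Qed.

Let redb_per : redb B Q n%:Z = redb B Q 0.
Proof.
have Bn : B n%:Z = B 0 by rewrite -[n%:Z]add0r B_per.
have Qn : Q n%:Z = Q 0 by rewrite -[n%:Z]add0r Q_per.
by rewrite /redb [n%:Z + 1]addrC Q_per Bn Qn add0r.
Qed.

(** The reduced Hill formula of a linear system with symmetric operators A_i. *)
Theorem reduced_hill_formula :
  det_end (Pt - \1)%VF * det_boldBperp Lam n e = det_Hperp Lam n w e.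
Proof.
have W_per i : W (i + n%:Z) = W i by apply/matrixP => r a; rewrite !mxE w_per.
have [u [Y [c [u_traj u0 u1 [Y0 Y1 Yrec] [un un1]]]]] :=
  reduced_monodromy A_sym B_unit W_traj Wmx_isotropic gram_unit
    Q_mem Q_span Q_inj B_per W_per Q_per.
rewrite -/l0 -/l1 in u0 u1 un un1.
set M := col_mx _ _ in un un1.
have PJ z : Pt (J z) = J (M *m z).
  have P_lift : P (l0 *m z, l1 *m z) =
      (l0 *m (M *m z), l1 *m (M *m z)) + (W 0 *m (c *m z), W 1 *m (c *m z)).
    have := P_poincare (mx_traj_col z u_traj).
    by rewrite u0 u1 un un1 !mulmxDl !mulmxA.
  have PV : P (l0 *m z, l1 *m z) - (l0 *m (M *m z), l1 *m (M *m z)) \in V.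
    by rewrite P_lift addrC addKr; apply/mem_fix_space; exists (c *m z).
  have PVo : P (l0 *m z, l1 *m z) \in Vo.
    rewrite -(subrK (l0 *m (M *m z), l1 *m (M *m z)) (P _)).
    by rewrite memvD // (subvP isotropic_sub).
  rewrite /J (Pt_induced (u' := vsproj Vo (P (l0 *m z, l1 *m z)))).
    exact: prj_eq.
  by rewrite !vsprojK.
(* det (1 - M) = det (M - 1), as the dimension d + d is even. *)
have -> : det_end (Pt - \1)%VF = \det (1%:M - M).
  have -> : \det (1%:M - M) = \det (M - 1%:M).
    by rewrite -opprB -scaleN1r detZ -signr_odd oddD addbb mul1r.
  apply: (det_end_intertwine J_inj J_surj) => z.
  by rewrite !lfun_simp PJ mulmxBl mul1mx linearB.
rewrite (det_Hperp_bmx e gram_symW) det_boldBperp_bmx mulrC.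
rewrite (@hill_formula _ n d (fun i => reda A B W Q i%:Z)
  (fun i => redb B Q i%:Z) n_gt0 (fun i => Y i%:Z)) //.
  by rewrite /M; congr (_ * \det (_ - col_mx _ (Y _))); lia.
move=> i _; have := Yrec i.+1%:Z.
have -> : i.+1%:Z - 1 = i%:Z by lia.
have -> : i.+1%:Z + 1 = i.+2%:Z by lia.
by move/eqP; rewrite subr_eq0 => /eqP ->.
Qed.

Lemma det_boldBperpE : det_boldBperp Lam n e =
  (-1) ^+ d * \prod_(1 <= i < n.+1) det_Bperp Lam e i%:Z.
Proof.
rewrite det_boldBperp_bmx det_shift_mxE //.
rewrite big_add1 big_mkord; congr (_ * _); apply: eq_bigr => i _.
by rewrite det_Bperp_mx.
Qed.

Lemma det_Bperp_neq0 i : det_Bperp Lam e i != 0.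
Proof. by rewrite det_Bperp_mx -unitfE -unitmxE. Qed.

End Monodromy.

Theorem corollary3p1 (R : realType) (m n k : nat) (n_gt0 : (0 < n)%N)
  (M : topologicalType) (atl : set (chart R m M)) (mfdM : is_manifold atl)
  (L : M -> M -> R) (L_C2 : C2_lagrangian L atl)
  (x : int -> M) (x_per : nperiodic n x)
  (phi : int -> chart R m M) (phi_per : nperiodic n phi)
  (phi_atl : forall i, atl (phi i))
  (phi_x : forall i, chart_dom (phi i) (x i))
  (x_traj : is_trajectory L phi x)
  (Lam : linear_system R m) (LamE : Lam = linearization L phi x)
  (B_nondeg : forall i, opB Lam i \in unitmx)
  (P : 'End(('cV[R]_m * 'cV[R]_m)%type)) (P_poincare : is_poincare_map Lam n P)
  (V : {vspace ('cV[R]_m * 'cV[R]_m)%type})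
  (V_fix : (V <= lker (P - \1)%VF)%VS) (V_isotropic : isotropic Lam V)
  (V_dim : \dim V = k)
  (w : 'I_k -> int -> 'cV[R]_m)
  (w_traj : forall a, is_lin_trajectory Lam (w a))
  (w_per : forall a, nperiodic n (w a))
  (w_basis : basis_of V [tuple (w a 0, w a 1) | a < k])
  (G_nondeg : forall i, matG Lam w i \in unitmx)
  (Wt : vectType R) (prj : 'Hom(subvs_of (omega_orth Lam V), Wt))
  (prj_quot : is_quotient_map V prj)
  (Pt : 'End(Wt)) (Pt_induced : is_induced_map prj P Pt)
  (e : int -> (m - k).-tuple 'cV[R]_m) (e_per : nperiodic n e)
  (e_basis : forall i, basis_of (Eperp Lam w i) (e i)) :
  [/\ det_boldBperp Lam n e != 0,
      det_end (Pt - \1)%VF = det_Hperp Lam n w e / det_boldBperp Lam n e &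
      exists sigma beta : R,
        [/\ sigma = 1 \/ sigma = -1, 0 < beta,
            sigma * beta = (\prod_(1 <= i < n.+1) det_Bperp Lam e i%:Z)^-1 &
            det_Hperp Lam n w e / det_boldBperp Lam n e
              = sigma * (-1) ^+ (m - k) * beta * det_Hperp Lam n w e]].
Proof.
have A_sym i : (opA Lam i)^T = opA Lam i.
  by rewrite LamE; exact: (linearization_opA_sym mfdM L_C2 phi_atl phi_x).
have B_per : nperiodic n (opB Lam).
  by rewrite LamE; exact: (linearization_opB_per L x_per phi_per).
have hill := reduced_hill_formula w_basis V_isotropic A_sym B_nondeg w_traj
  G_nondeg e_basis n_gt0 B_per w_per e_per P_poincare prj_quot Pt_induced.
have boldBE := det_boldBperpE n_gt0 B_per e_per.
set p := \prod_(1 <= i < n.+1) det_Bperp Lam e i%:Z in boldBE *.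
have p_neq0 : p != 0.
  rewrite /p prodf_seq_neq0; apply/allP => i _ /=.
  exact: (det_Bperp_neq0 w_basis V_isotropic A_sym B_nondeg w_traj G_nondeg
    e_basis).
have boldB_neq0 : det_boldBperp Lam n e != 0.
  by rewrite boldBE mulf_neq0 // signr_eq0.
split=> //; first by rewrite -hill mulfK.
exists (Num.sg p^-1), `|p^-1|; split.
- by rewrite /Num.sg invr_eq0 (negPf p_neq0); case: ifP => _; [right|left].
- by rewrite normr_gt0 invr_eq0.
- by rewrite -numEsg.
by rewrite boldBE invfM invr_sign [in LHS](numEsg p^-1); ring.
Qed.
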